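(* Let $\alpha>1$. If $x>0$, $y\in\mathbb R$, and $$\Gamma\left(\frac\alpha2+x+iy\right)\Gamma\left(\frac\alpha2-x-iy\right)$$ is finite, then $$\left|\Gamma\left(\frac\alpha2+x+iy\right)\Gamma\left(\frac\alpha2-x-iy\right)\right|>\left|\Gamma\left(\frac\alpha2+iy\right)\right|^2.$$
   Context: $\Gamma$ is the Gamma function, meromorphic on $\mathbb C$ with poles at $0,-1,-2,\dots$; ''finite'' means that $\frac\alpha2-x-iy$ is not a pole of $\Gamma$. *)

(* Defs.v *)
From HB Require Import structures.
From mathcomp Require Import all_boot all_order all_algebra archimedean.
From mathcomp Require Import all_classical all_reals all_analysis.
From mathcomp Require Import complex.

Set Implicit Arguments.
Unset Strict Implicit.
Unset Printing Implicit Defensive.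

Import Order.TTheory GRing.Theory Num.Theory.

Local Open Scope classical_set_scope.
Local Open Scope ring_scope.
Local Open Scope complex_scope.

Definition expC (R : realType) (z : R[i]) : R[i] :=
  let: a +i* b := z in (expR a * cos b) +i* (expR a * sin b).

(* t ^ (z - 1) * e ^ (- t), where t ^ w = exp (w * ln t) for t > 0 *)
Definition Gamma_integrand (R : realType) (z : R[i]) (t : R) : R[i] :=
  expC ((z - 1) * (ln t)%:C) * (expR (- t))%:C.

(* Euler's integral of the second kind, absolutely convergent for Re z > 0 *)
Definition Euler_Gamma (R : realType) (z : R[i]) : R[i] :=
  (\int[lebesgue_measure]_(t in `]0, +oo[) complex.Re (Gamma_integrand z t))
  +i* (\int[lebesgue_measure]_(t in `]0, +oo[) complex.Im (Gamma_integrand z t)).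

(* The least n such that Re z + n > 0 *)
Definition Gamma_shift (R : realType) (z : R[i]) : nat :=
  if 0 < complex.Re z then 0%N else (Num.truncn (- complex.Re z)).+1.

Definition Gamma_pole (R : realType) (z : R[i]) : Prop :=
  exists k : nat, z = - k%:R.

(* The meromorphic continuation of Euler's integral, obtained from the
   functional equation Gamma (z + n) = z (z + 1) ... (z + n - 1) Gamma z.
   At a pole the denominator vanishes, and the value is the junk value 0. *)
Definition Gamma (R : realType) (z : R[i]) : R[i] :=
  let n := Gamma_shift z in
  Euler_Gamma (z + n%:R) / \prod_(k < n) (z + k%:R).

Lemma Re_Gamma_shift_gt0 (R : realType) (z : R[i]) :
  0 < complex.Re (z + (Gamma_shift z)%:R).
Proof.
have -> n : complex.Re (z + n%:R) = complex.Re z + n%:R.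
  by case: z => a b; rewrite -(rmorph_nat (real_complex R)).
rewrite /Gamma_shift; case: (ltP 0 (complex.Re z)) => [z_gt0 | z_le0]; first by rewrite addr0.
have: 0 <= - complex.Re z by rewrite oppr_ge0.
by move/truncn_itv/andP => [_]; rewrite -subr_gt0 opprK addrC.
Qed.

Lemma Gamma_poleE (R : realType) (z : R[i]) :
  Gamma_pole z <-> \prod_(k < Gamma_shift z) (z + k%:R) = 0.
Proof.
split=> [[k zk] | /eqP/prodf_eq0[k _ /eqP zk0]]; last first.
  by exists (k : nat); apply/eqP; rewrite -addr_eq0 zk0.
have := Re_Gamma_shift_gt0 z.
have -> : z + (Gamma_shift z)%:R = ((Gamma_shift z)%:R - k%:R : R)%:C.
  by rewrite rmorphB/= !rmorph_nat {1}zk addrC.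
rewrite /= subr_gt0 ltr_nat => ltk.
by apply/eqP/prodf_eq0; exists (Ordinal ltk); rewrite //= zk addNr.
Qed.

(* Main.v *)
(* Write M_n(z) for the product over k < n of (z + k + x)(z + k - x) / (z + k)^2. Up to the
   factor Gamma(z + n)^2 / (Gamma(z + n + x) Gamma(z + n - x)), it is the quotient
   Gamma(z)^2 / (Gamma(z + x) Gamma(z - x)), whose modulus must be shown to be < 1 at
   z = alpha/2 + i y. On the line Re z = 1/2 the limit has squared modulus
   (cosh 2 pi v + cos 2 pi x) / (cosh 2 pi v + 1) <= 1, uniformly in v up to a factor
   1 + O(1/n): this comes from the finite products of cosh b - cos (phi + 2 pi j / 2^r) and
   replaces the reflection formula. The maximum principle on Re z > 1/2 then bounds M_n; for
   finite products of linear fractions it is proved by averaging over N-th roots of -u^N and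
   letting N grow. Strictness comes from the strict boundary bound if x <= 1/2, and from the
   zero of M_n at z = x if x > 1/2. The remaining Gamma factor is asymptotically at most 1 by
   log-convexity on the real axis and |Gamma(s + i y)| ~ Gamma(s). *)
Require Import Defs.
From mathcomp Require Import all_boot all_order all_algebra.
From mathcomp Require Import all_classical all_reals all_analysis.
From mathcomp Require Import complex.
From mathcomp Require Import measurable_realfun.
From mathcomp Require Import ring lra zify.

Import Order.TTheory GRing.Theory Num.Theory.
Import numFieldNormedType.Exports.
Local Open Scope ring_scope.
Local Open Scope complex_scope.

Set Implicit Arguments.
Unset Strict Implicit.
Unset Printing Implicit Defensive.

Import ComplexField.Normc.

Section Modulus.
Variable R : rcfType.
Implicit Types z w : R[i].

Lemma normc_ge0 z : 0 <= normc z.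
Proof. by case: z => a b; exact: sqrtr_ge0. Qed.

Lemma normrE z : `|z| = (normc z)%:C.
Proof. by case: z. Qed.

Lemma normc_gt0 z : (0 < normc z) = (z != 0).
Proof. by rewrite -ltcR -normrE normr_gt0. Qed.

Lemma normcX z n : normc (z ^+ n) = normc z ^+ n.
Proof. by elim: n => [|n IH]; rewrite ?expr0 ?normc1// !exprS normcM IH. Qed.

Lemma normc_prod (I : Type) (r : seq I) (P : pred I) (F : I -> R[i]) :
  normc (\prod_(i <- r | P i) F i) = \prod_(i <- r | P i) normc (F i).
Proof. exact: (big_morph _ (@normcM R) (normc1 R)). Qed.

Lemma normc_subl z w : normc z - normc w <= normc (z - w).
Proof. by rewrite -lecR rmorphB/= -!normrE lerB_dist. Qed.

Lemma normc_subD z w : normc (z - w) <= normc z + normc w.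
Proof. by rewrite -lecR rmorphD/= -!normrE ler_normB. Qed.

Lemma normcN z : normc (- z) = normc z.
Proof. by apply: complexI; rewrite -!normrE normrN. Qed.

Lemma sqr_normcE (a b : R) : normc (a +i* b) ^+ 2 = a ^+ 2 + b ^+ 2.
Proof. by rewrite sqr_sqrtr ?addr_ge0 ?sqr_ge0. Qed.

End Modulus.

Section MaximumModulus.
Variable R : realType.
Local Notation C := R[i].

Lemma prod_sub_roots (N : nat) (e : C) : (0 < N)%N ->
  exists s : seq C, [/\ size s = N,
    forall w, w \in s -> w ^+ N = e &
    forall a b : C, \prod_(w <- s) (a - b * w) = a ^+ N - e * b ^+ N].
Proof.
move=> N0; have [s sE] := closed_field_poly_normal ('X^N - e%:P).
have lc : lead_coef ('X^N - e%:P : {poly C}) = 1.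
  by apply/eqP; rewrite -monicE monicXnsubC.
rewrite lc scale1r in sE.
have szs : size s = N.
  by have := size_XnsubC e N0; rewrite sE size_prod_XsubC => -[].
exists s; split=> // [w ws|a b].
  have : root ('X^N - e%:P) w by rewrite sE root_prod_XsubC.
  by rewrite rootE !hornerE subr_eq0 => /eqP.
have ev c : \prod_(w <- s) (c - w) = c ^+ N - e.
  have <- : ('X^N - e%:P).[c] = c ^+ N - e by rewrite !hornerE.
  by rewrite sE horner_prod; apply: eq_bigr => w _; rewrite !hornerE.
have [->|b0] := eqVneq b 0.
  under eq_bigr do rewrite mul0r subr0.
  by rewrite big_const_seq count_predT szs iter_mulr_1 expr0n gtn_eqF// mulr0 subr0.
rewrite (eq_bigr (fun w => b * (a / b - w))) => [|w _]; last first.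
  by rewrite mulrBr mulrCA divff// mulr1.
rewrite big_split/= ev big_const_seq count_predT szs iter_mulr_1.
by rewrite mulrBr -exprMn mulrCA divff// mulr1 [b ^+ _ * e]mulrC.
Qed.

Lemma unbounded_exprn (r K : R) : 1 < r -> exists N, (0 < N)%N /\ K < r ^+ N.
Proof.
move=> r1; have r10 : 0 < r - 1 by rewrite subr_gt0.
have bern n : 1 + n%:R * (r - 1) <= r ^+ n.
  elim: n => [|n IH]; first by rewrite mul0r addr0 expr0.
  rewrite exprS; have : 0 <= n%:R * (r - 1) ^+ 2 :> R by rewrite mulr_ge0// sqr_ge0.
  have : r * (1 + n%:R * (r - 1)) <= r * r ^+ n by rewrite ler_pM2l// (lt_trans _ r1).
  rewrite -natr1; nra.
have /archi_boundP : 0 <= `|K| / (r - 1) by rewrite divr_ge0// ltW.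
set n := Num.bound _ => Hn; exists n.+1; split => //.
apply: lt_le_trans (bern _).
move: Hn; rewrite ltr_pdivrMr// => Hn.
have := ler_norm K; rewrite -natr1; nra.
Qed.

Lemma rootN_separation (u a b : C) : normc u = 1 ->
  normc a != normc b \/ a = u * b ->
  exists k : R, 0 < k /\ forall N, (0 < N)%N ->
    k * Num.max (normc a) (normc b) ^+ N <= normc (a ^+ N - (- u ^+ N) * b ^+ N).
Proof.
move=> u1 ab.
have gap (p q : R) N : (0 < N)%N -> 0 <= p -> p < q -> (1 - p / q) * q ^+ N <= q ^+ N - p ^+ N.
  case: N => // N _ p0 pq; have q0 : 0 < q by exact: le_lt_trans pq.
  rewrite mulrBl mul1r lerD2l lerN2 [q ^+ _]exprS mulrA divfK ?gt_eqF// exprS.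
  by rewrite ler_wpM2l// lerXn2r// ?nnegrE// ltW.
have pos (p q : R) : 0 <= p -> p < q -> 0 < 1 - p / q.
  move=> p0 pq; rewrite subr_gt0 ltr_pdivrMr ?mul1r//; exact: le_lt_trans pq.
have nE N : normc ((- u ^+ N) * b ^+ N) = normc b ^+ N.
  by rewrite normcM normcN !normcX u1 expr1n mul1r.
have [lt|gt|e] := ltgtP (normc a) (normc b).
- exists (1 - normc a / normc b); split; first by rewrite pos ?normc_ge0.
  move=> N N0; apply: le_trans (gap _ _ _ N0 (normc_ge0 _) lt) _.
  rewrite -[leRHS]normcN opprB -nE -normcX; exact: normc_subl.
- exists (1 - normc b / normc a); split; first by rewrite pos ?normc_ge0.
  move=> N N0; apply: le_trans (gap _ _ _ N0 (normc_ge0 _) gt) _.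
  rewrite -nE -normcX; exact: normc_subl.
- case: ab => [/eqP//|ab]; exists 1; split=> // N N0; rewrite mul1r.
  rewrite mulNr opprK -exprMn -ab -mulr2n -mulr_natl normcM normcX e.
  have -> : normc (2%:R : C) = 2%:R by apply: complexI; rewrite -normrE normr_nat rmorph_nat.
  by rewrite ler_peMl ?ler1n// exprn_ge0// normc_ge0.
Qed.

(* Averaging over the N-th roots of [- u ^+ N] replaces the mean value property of
   log |f|: the product of [a - b w] over these w is [a ^+ N + u ^+ N * b ^+ N],
   whose N-th root tends to the maximum of the moduli of [a] and [b]. *)
Lemma max_modulus_prod (I : finType) (A B P Q : I -> C) (u : C) (m : R) :
  0 <= m -> normc u = 1 ->
  (forall i, normc (A i) != normc (B i) \/ A i = u * B i) ->
  (forall i, normc (Q i) <= normc (P i)) ->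
  (forall w, normc w = 1 ->
    \prod_i normc (A i - B i * w) <= m * \prod_i normc (P i - Q i * w)) ->
  \prod_i Num.max (normc (A i)) (normc (B i)) <= m * \prod_i normc (P i).
Proof.
move=> m0 u1 AB QP H; rewrite leNgt; apply/negP.
set L := \prod_i Num.max _ _; set Z := m * _ => ZL.
have Z0 : 0 <= Z by rewrite mulr_ge0// prodr_ge0// => i _; exact: normc_ge0.
have L0 : 0 < L by exact: le_lt_trans ZL.
have [k kP] := choice (fun i => rootN_separation u1 (AB i)).
pose K := \prod_i k i.
have K0 : 0 < K by rewrite prodr_gt0// => i _; have [] := kP i.
have main N : (0 < N)%N -> K * L ^+ N <= 2 ^+ #|I| * Z ^+ N.
  move=> N0; have [s [szs ws sE]] := prod_sub_roots (- u ^+ N) N0.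
  have w1 w : w \in s -> normc w = 1.
    move=> /ws wN; apply/eqP; rewrite -(@pexpr_eq1 _ _ N) ?normc_ge0//.
    by rewrite -normcX wN normcN normcX u1 expr1n.
  have : \prod_(w <- s) \prod_i normc (A i - B i * w) <=
         \prod_(w <- s) (m * \prod_i normc (P i - Q i * w)).
    rewrite big_seq [leRHS]big_seq; apply: ler_prod => w wins.
    by rewrite prodr_ge0 ?H ?w1// => i _; exact: normc_ge0.
  rewrite big_split/= big_const_seq count_predT szs iter_mulr_1.
  rewrite exchange_big/= [X in _ <= _ * X]exchange_big/=.
  under eq_bigr do rewrite -normc_prod sE.
  under [X in _ <= _ * X]eq_bigr do rewrite -normc_prod sE.
  move=> h; apply: le_trans (le_trans _ h) _.
    rewrite -prodrXl -big_split/=; apply: ler_prod => i _.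
    have [k0 kN] := kP i; rewrite kN// andbT mulr_ge0 ?(ltW k0)// exprn_ge0//.
    by rewrite le_max normc_ge0.
  rewrite exprMn mulrCA ler_wpM2l ?exprn_ge0//.
  rewrite -prodrXl -prodr_const -big_split/=; apply: ler_prod => i _.
  rewrite normc_ge0/=; apply: le_trans (normc_subD _ _) _.
  rewrite normcM normcN !normcX u1 expr1n mul1r mulr2n mulrDl mul1r lerD2l.
  by rewrite lerXn2r ?nnegrE ?normc_ge0.
have [Ze|Zn] := eqVneq Z 0.
  have := main 1 isT; rewrite Ze !expr1 mulr0 leNgt mulr_gt0//.
have Zp : 0 < Z by rewrite lt_def Zn.
have r1 : 1 < L / Z by rewrite ltr_pdivlMr// mul1r.
have [N [N0]] := unbounded_exprn (2 ^+ #|I| / K) r1.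
rewrite ltr_pdivrMr// expr_div_n mulrAC ltr_pdivlMr ?exprn_gt0// mulrC.
by rewrite [_ * K]mulrC => /lt_le_trans/(_ (main _ N0)); rewrite mulrC ltxx.
Qed.

End MaximumModulus.

Section CoshCosProducts.
Variable R : realType.
Implicit Types b c phi x v t : R.

Definition coshR b : R := (expR b + expR (- b)) / 2.

Lemma coshR0 : coshR 0 = 1.
Proof. by rewrite /coshR oppr0 expR0 -[1 + 1]/(2%:R) divff. Qed.

Lemma coshR_sqr b : coshR (b *+ 2) = 2 * coshR b ^+ 2 - 1.
Proof.
rewrite /coshR mulr2n opprD !expRD !expRN.
have := lt0r_neq0 (expR_gt0 b); move: (expR b) => e e0; field.
exact: e0.
Qed.

Lemma coshR_ge1 b : 1 <= coshR b.
Proof.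
rewrite /coshR ler_pdivlMr// mul1r; have := expRxMexpNx_1 b.
have := expR_gt0 b; have := expR_gt0 (- b).
move: (expR b) (expR (- b)) => p q q0 p0 pq; have := sqr_ge0 (p - q).
have [//|h] := leP 2 (p + q); nra.
Qed.

Lemma coshR_norm b : coshR `|b| = coshR b.
Proof. by case: (ger0P b) => // _; rewrite /coshR opprK addrC. Qed.

Lemma ler_coshR b c : `|b| <= c -> coshR b <= coshR c.
Proof.
rewrite -coshR_norm; move: `|b| (normr_ge0 b) => {}b b0 bc.
rewrite /coshR ler_pM2r//; have bc' : expR b <= expR c by rewrite ler_expR.
have := expRxMexpNx_1 b; have := expRxMexpNx_1 c.
have := expR_gt0 (- b); have := expR_gt0 (- c).
have : 1 <= expR b by rewrite -(@expR0 R) ler_expR.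
move: (expR b) (expR c) (expR (- b)) (expR (- c)) bc' => p q p' q' pq p1 q0 p0 eq ep.
have p_n0 : p != 0 by rewrite gt_eqF//; lra.
have q_n0 : q != 0 by rewrite gt_eqF//; lra.
have -> : p' = p^-1 by rewrite -[RHS]mulr1 -ep mulKf.
have -> : q' = q^-1 by rewrite -[RHS]mulr1 -eq mulKf.
rewrite -subr_ge0.
have -> : q + q^-1 - (p + p^-1) = (q - p) * (p * q - 1) / (p * q).
  by field; rewrite p_n0 q_n0.
by rewrite divr_ge0 ?mulr_ge0//; nra.
Qed.

Lemma cosh_cos_double b phi :
  (2 * (coshR b - cos phi)) * (2 * (coshR b - cos (phi + pi))) =
  2 * (coshR (b *+ 2) - cos (phi *+ 2)).
Proof. by rewrite cosDpi coshR_sqr cos_mulr2n; ring. Qed.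

Lemma prod_cosh_cos r b phi :
  \prod_(j < 2 ^ r) (2 * (coshR b - cos (phi + 2 * pi * j%:R / 2 ^+ r))) =
  2 * (coshR (2 ^+ r * b) - cos (2 ^+ r * phi)).
Proof.
elim: r b phi => [|r IH] b phi.
  by rewrite expn0 big_ord1 expr0 !mul1r mulr0 mul0r addr0.
rewrite expnS mul2n -addnn big_split_ord/= -big_split/=.
have p2 : 2 ^+ r != 0 :> R by rewrite expf_neq0.
rewrite (eq_bigr (fun j : 'I_(2 ^ r) => 2 * (coshR (b *+ 2) -
  cos (phi *+ 2 + 2 * pi * j%:R / 2 ^+ r)))) => [|j _].
  rewrite IH exprS (_ : 2 ^+ r * (b *+ 2) = 2 * 2 ^+ r * b); last by rewrite mulr2n; ring.
  by rewrite (_ : 2 ^+ r * (phi *+ 2) = 2 * 2 ^+ r * phi)// mulr2n; ring.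
rewrite (_ : phi + 2 * pi * (2 ^ r + j)%:R / 2 ^+ r.+1 =
  phi + 2 * pi * j%:R / 2 ^+ r.+1 + pi).
  rewrite cosh_cos_double (_ : (phi + _) *+ 2 = phi *+ 2 + 2 * pi * j%:R / 2 ^+ r)//.
  by rewrite !mulr2n exprS; field.
by rewrite natrD natrX exprS; field.
Qed.

Definition lattice_factor r v t : R :=
  coshR (2 * pi * v / 2 ^+ r) - cos (2 * pi * t / 2 ^+ r).

Lemma prod_lattice_factor r x v :
  \prod_(k < 2 ^ r) (2 * lattice_factor r.+1 v (k%:R + 2^-1 + x) *
                     (2 * lattice_factor r.+1 v (k%:R + 2^-1 - x))) =
  2 * (coshR (2 * pi * v) + cos (2 * pi * x)).
Proof.
have p2 : 2 ^+ r != 0 :> R by rewrite expf_neq0.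
have := prod_cosh_cos r.+1 (2 * pi * v / 2 ^+ r.+1) (2 * pi * (2^-1 + x) / 2 ^+ r.+1).
rewrite ![2 ^+ r.+1 * _]mulrC !divfK ?expf_neq0//.
have -> : 2 * pi * (2^-1 + x) = 2 * pi * x + pi by field.
rewrite cosDpi opprK => <-.
rewrite [in RHS]expnS mul2n -addnn [RHS]big_split_ord/= big_split/=; congr (_ * _).
  apply: eq_bigr => k _; congr (_ * (_ - cos _)); rewrite exprS; field; exact: p2.
rewrite [RHS](reindex_inj rev_ord_inj)/=; apply: eq_bigr => k _.
congr (_ * (_ - _)); rewrite -cosN -cosD2pi; congr cos.
have -> : ((2 ^ r + (2 ^ r - k.+1))%:R : R) = 2 ^+ r + (2 ^+ r - k%:R - 1).
  by rewrite natrD natrB// -natr1 [(2 ^ r)%:R]natrX; ring.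
by rewrite exprS; field.
Qed.

End CoshCosProducts.

Section BoundaryEstimate.
Variable R : realType.
Implicit Types b phi x v t u : R.

Lemma sin_mvt u : 0 <= u -> exists2 c, c \in `[0, u] & sin u = cos c * u.
Proof.
move=> u0.
have [c cu sE] : exists2 c, c \in `[0, u] & sin u - sin 0 = cos c * (u - 0).
  apply: (@MVT_segment R sin cos) => //.
  by apply: continuous_subspaceT => y; exact: continuous_sin.
by exists c; rewrite // sin0 !subr0 in sE *.
Qed.

Lemma one_sub_cos u : 1 - cos u = 2 * sin (u / 2) ^+ 2.
Proof.
rewrite -{1}[u](_ : (u / 2) *+ 2 = u); last by rewrite -mulr_natr divfK.
rewrite cos_mulr2n cos2sin2; ring.
Qed.

Lemma one_sub_cos_le u : 1 - cos u <= u ^+ 2 / 2.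
Proof.
wlog u0 : u / 0 <= u => [h|].
  by have [/h//|/ltW u0] := leP 0 u; rewrite -cosN -sqrrN h// oppr_ge0.
have [c _ sE] : exists2 c, c \in `[0, u / 2] & sin (u / 2) = cos c * (u / 2).
  by apply: sin_mvt; rewrite divr_ge0.
rewrite one_sub_cos sE; have : cos c ^+ 2 <= 1 by rewrite cos2sin2 gerBl sqr_ge0.
by rewrite exprMn; have := sqr_ge0 (u / 2); rewrite (_ : u ^+ 2 / 2 = 2 * (u / 2) ^+ 2); [nra|field].
Qed.

Lemma one_sub_cos_ge u : 0 <= u -> u <= pi -> u ^+ 2 / 8 <= 1 - cos u.
Proof.
move=> u0 upi; set w := u / 4.
have uE : u / 2 = w *+ 2 by rewrite /w -mulr_natr; field.
have w0 : 0 <= w by rewrite divr_ge0.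
have w2 : w *+ 2 <= pi / 2 by rewrite -uE ler_pM2r.
have cw : 1 <= 2 * cos w ^+ 2.
  rewrite -subr_ge0 mulr_natl -cos_mulr2n cos_ge0_pihalf// w2 andbT.
  by rewrite (@le_trans _ _ 0)// ?oppr_le0 ?divr_ge0 ?pi_ge0// mulrn_wge0.
have [c] := sin_mvt w0; rewrite in_itv/= => /andP[c0 cw'] sE.
have wpi : w <= pi by move: w2 (@pi_ge0 R); rewrite -mulr_natr; lra.
have cos_w : cos w <= cos c.
  by rewrite leNgt ltr_cos ?in_itv/= ?c0 ?w0 ?(le_trans cw') -?leNgt.
have cos_w0 : 0 <= cos w.
  by apply: cos_ge0_pihalf; move: w2 (@pi_ge0 R); rewrite -mulr_natr; lra.
have sw : w * cos w <= sin w by rewrite sE mulrC ler_wpM2r.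
have sw2 : w ^+ 2 / 2 <= sin w ^+ 2.
  have : (w * cos w) ^+ 2 <= sin w ^+ 2.
    by rewrite lerXn2r ?nnegrE ?mulr_ge0// (le_trans _ sw)// mulr_ge0.
  by rewrite exprMn; apply: le_trans; have := sqr_ge0 w; nra.
rewrite one_sub_cos uE sin_mulr2n mulr2n.
have -> : u ^+ 2 / 8 = 2 * w ^+ 2 by rewrite /w; field.
have -> : 2 * (cos w * sin w + cos w * sin w) ^+ 2 = 4 * ((2 * cos w ^+ 2) * sin w ^+ 2) by ring.
have := sqr_ge0 (sin w); nra.
Qed.

Lemma lattice_factor_ge0 r v t : 0 <= lattice_factor r v t.
Proof. by rewrite subr_ge0 (le_trans (cos_le1 _))// coshR_ge1. Qed.

Lemma lattice_angle r t : 0 <= t -> t <= 2 ^+ r / 2 -> 0 <= 2 * pi * t / 2 ^+ r <= pi.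
Proof.
move=> t0 tr; have p : 0 < 2 ^+ r :> R by rewrite exprn_gt0.
have p0 := @pi_ge0 R.
rewrite !mulr_ge0 ?invr_ge0 ?(ltW p)//= ler_pdivrMr//.
by rewrite mulrAC mulrC ler_wpM2l//; lra.
Qed.

Lemma lattice_factor_lower r v t : 0 <= t -> t <= 2 ^+ r / 2 ->
  (2 * pi * t / 2 ^+ r) ^+ 2 / 8 <= lattice_factor r v t.
Proof.
move=> t0 tr; have /andP[a0 api] := lattice_angle t0 tr.
by apply: le_trans (one_sub_cos_ge a0 api) _; rewrite lerD2r coshR_ge1.
Qed.

Lemma lattice_factor_gt0 r v t : 0 < t -> t <= 2 ^+ r / 2 -> 0 < lattice_factor r v t.
Proof.
move=> t0 tr; apply: lt_le_trans (lattice_factor_lower _ (ltW t0) tr).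
by rewrite divr_gt0// exprn_gt0// divr_gt0 ?exprn_gt0// !mulr_gt0// pi_gt0.
Qed.

Lemma lattice_factor_tail r v t x : 0 < t -> t <= 2 ^+ r / 2 ->
  coshR (2 * pi * v / 2 ^+ r) <= 2 ->
  (1 - 16 * x ^+ 2 / t ^+ 2) * lattice_factor r v t ^+ 2 <=
  lattice_factor r v (t + x) * lattice_factor r v (t - x).
Proof.
move=> t0 tr; rewrite /lattice_factor.
have := lattice_factor_lower v (ltW t0) tr; rewrite /lattice_factor.
have -> : 2 * pi * (t + x) / 2 ^+ r = 2 * pi * t / 2 ^+ r + 2 * pi * x / 2 ^+ r by ring.
have -> : 2 * pi * (t - x) / 2 ^+ r = 2 * pi * t / 2 ^+ r - 2 * pi * x / 2 ^+ r by ring.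
have -> : 16 * x ^+ 2 / t ^+ 2 =
    16 * (2 * pi * x / 2 ^+ r) ^+ 2 / (2 * pi * t / 2 ^+ r) ^+ 2.
  have pi_n0 : pi != 0 :> R by rewrite gt_eqF// pi_gt0.
  have p2 : 2 ^+ r != 0 :> R by rewrite expf_neq0.
  by move: pi pi_n0 => p p_n0; field; rewrite p2 p_n0 gt_eqF.
have B0 : 0 < 2 * pi * t / 2 ^+ r.
  by rewrite divr_gt0 ?exprn_gt0// !mulr_gt0// pi_gt0.
have := coshR_ge1 (2 * pi * v / 2 ^+ r).
move: (coshR _) (2 * pi * t / _) B0 (2 * pi * x / _) => c B B0 X c1 lower c2.
rewrite cosB cosD.
have XX := one_sub_cos_le X.
have sB := sin2cos2 B; have sX := sin2cos2 X.
have cX1 := cos_le1 X; have cB1 := cos_le1 B.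
have B2 : 0 < B ^+ 2 by rewrite exprn_gt0.
rewrite -subr_ge0.
have -> : (c - (cos B * cos X - sin B * sin X)) * (c - (cos B * cos X + sin B * sin X)) =
  (c - cos B * cos X) ^+ 2 - sin B ^+ 2 * sin X ^+ 2 by ring.
rewrite sB sX.
set q := 16 * X ^+ 2 / B ^+ 2.
have qE : q * B ^+ 2 = 16 * X ^+ 2 by rewrite /q divfK// gt_eqF.
have q0 : 0 <= q by rewrite /q mulr_ge0 ?invr_ge0 ?(ltW B2)// mulr_ge0 ?sqr_ge0.
have h1 : 2 * X ^+ 2 <= q * (c - cos B).
  have : q * (B ^+ 2 / 8) <= q * (c - cos B) by rewrite ler_wpM2l.
  by rewrite mulrA qE; lra.
have cB0 : 0 <= c - cos B by lra.
have h2 : 2 * X ^+ 2 * (c - cos B) <= q * (c - cos B) ^+ 2.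
  by rewrite [(c - cos B) ^+ 2]expr2 mulrA ler_wpM2r.
have h3 : (1 - cos X) * (1 + cos X - 2 * c * cos B) <= 2 * X ^+ 2 * (c - cos B).
  have e1 : 1 + cos X - 2 * c * cos B <= 4 * (c - cos B) by nra.
  apply: (@le_trans _ _ ((1 - cos X) * (4 * (c - cos B)))); first by rewrite ler_wpM2l//; lra.
  rewrite (_ : 2 * X ^+ 2 * (c - cos B) = X ^+ 2 / 2 * (4 * (c - cos B))); last by field.
  by rewrite ler_wpM2r// mulr_ge0.
nra.
Qed.

Lemma prod_one_sub_ge (K : R) (n m : nat) : 0 <= K -> (0 < n)%N -> K <= n%:R -> (n <= m)%N ->
  1 - K * (n%:R^-1 - m%:R^-1) <= \prod_(n <= k < m) (1 - K / (k%:R + 2^-1) ^+ 2).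
Proof.
move=> K0 n0 Kn; elim: m => [|m IH] nm; first by rewrite big_geq//; lia.
move: nm; rewrite leq_eqVlt => /orP[/eqP <-|nm]; first by rewrite big_geq// subrr mulr0 subr0.
rewrite big_nat_recr//=; have {}IH := IH nm.
have m1 : 1 <= m%:R :> R by rewrite ler1n; lia.
have n1 : 1 <= n%:R :> R by rewrite ler1n.
have mn : n%:R <= m%:R :> R by rewrite ler_nat.
set a := K * _ in IH; set b := K / _.
have b0 : 0 <= b by rewrite divr_ge0// sqr_ge0.
have b1 : b <= 1 by rewrite ler_pdivrMr; nra.
have a0 : 0 <= a by rewrite mulr_ge0// subr_ge0 lef_pV2 ?posrE; lra.
have bK : b <= K * (m%:R^-1 - m.+1%:R^-1).
  rewrite /b ler_wpM2l// -[m.+1%:R]natr1.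
  have -> : (m%:R^-1 - (m%:R + 1)^-1 : R) = (m%:R * (m%:R + 1))^-1.
    by field; rewrite !gt_eqF//; lra.
  by rewrite lef_pV2 ?posrE; nra.
apply: (@le_trans _ _ ((1 - a) * (1 - b))); last by rewrite ler_wpM2r// subr_ge0.
have -> : K * (n%:R^-1 - m.+1%:R^-1) = a + K * (m%:R^-1 - m.+1%:R^-1) by rewrite /a; ring.
by move: bK (mulr_ge0 a0 b0); move: (K * _) => d; lra.
Qed.

End BoundaryEstimate.

Section BoundaryLimit.
Variable R : realType.
Implicit Types v x t : R.

Definition boundary_ratio x v : R :=
  (coshR (2 * pi * v) + cos (2 * pi * x)) / (coshR (2 * pi * v) + 1).

Lemma lattice_boundary (r n : nat) x v : (0 < n)%N -> 16 * x ^+ 2 <= n%:R ->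
  (n <= 2 ^ r)%N -> coshR (2 * pi * v / 2 ^+ r.+1) <= 2 ->
  (1 - 16 * x ^+ 2 / n%:R) *
    \prod_(k < n) (lattice_factor r.+1 v (k%:R + 2^-1 + x) *
                   lattice_factor r.+1 v (k%:R + 2^-1 - x)) <=
  boundary_ratio x v * \prod_(k < n) lattice_factor r.+1 v (k%:R + 2^-1) ^+ 2.
Proof.
move=> n0 xn nr c2; set K := 16 * x ^+ 2.
pose g k := 2 * lattice_factor r.+1 v (k%:R + 2^-1 + x) *
            (2 * lattice_factor r.+1 v (k%:R + 2^-1 - x)).
pose h k := (2 * lattice_factor r.+1 v (k%:R + 2^-1)) ^+ 2.
have half k : (k < 2 ^ r)%N -> k%:R + 2^-1 <= 2 ^+ r.+1 / 2 :> R.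
  move=> kr; have : k.+1%:R <= (2 ^ r)%:R :> R by rewrite ler_nat.
  by rewrite exprS -natr1 natrX; lra.
have h0 k : (k < 2 ^ r)%N -> 0 < h k.
  by move=> kr; rewrite exprn_gt0// mulr_gt0// lattice_factor_gt0// ?half// ltr_wpDl.
have g0 k : 0 <= g k by rewrite !mulr_ge0 ?lattice_factor_ge0.
have full : \prod_(0 <= k < 2 ^ r) g k = boundary_ratio x v * \prod_(0 <= k < 2 ^ r) h k.
  rewrite !big_mkord /g prod_lattice_factor.
  have := prod_lattice_factor r 0 v; rewrite !mulr0 cos0.
  under eq_bigr do rewrite addr0 subr0 -expr2.
  move=> ->; rewrite /boundary_ratio mulrCA divfK// gt_eqF//.
  by have := coshR_ge1 (2 * pi * v); lra.
rewrite (big_cat_nat (n := n))//= [in RHS](big_cat_nat (n := n))//= in full.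
have tail : (1 - K / n%:R) * \prod_(n <= k < 2 ^ r) h k <= \prod_(n <= k < 2 ^ r) g k.
  have K0 : 0 <= K by rewrite mulr_ge0// sqr_ge0.
  have Hpos : 0 <= \prod_(n <= k < 2 ^ r) h k.
    by rewrite big_seq prodr_ge0// => k; rewrite mem_index_iota => /andP[_ /h0/ltW].
  have := prod_one_sub_ge K0 n0 xn nr => /(ler_wpM2r Hpos) P.
  apply: le_trans (le_trans _ P) _.
    rewrite ler_wpM2r// lerD2l lerN2 ler_wpM2l// gerBl invr_ge0//.
  rewrite -big_split/= big_seq [leRHS]big_seq; apply: ler_prod => k.
  rewrite mem_index_iota => /andP[nk kr].
  have k1 : n%:R <= k%:R :> R by rewrite ler_nat.
  have k0 : 1 <= n%:R :> R by rewrite ler1n.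
  rewrite mulr_ge0 ?(ltW (h0 _ kr))//=.
    have := @lattice_factor_tail R r.+1 v (k%:R + 2^-1) x _ (half _ kr) c2.
    rewrite /g /h -/K => /(_ ltac:(lra)); nra.
  have b0 : 0 < k%:R + 2^-1 :> R by lra.
  rewrite subr_ge0 ler_pdivrMr ?mul1r ?exprn_gt0//.
  by apply: le_trans xn _; nra.
have Hpos : 0 < \prod_(n <= k < 2 ^ r) h k.
  by rewrite big_seq prodr_gt0// => k; rewrite mem_index_iota => /andP[_ /h0].
have Gpos : 0 <= \prod_(0 <= k < n) g k by rewrite prodr_ge0.
have : (1 - K / n%:R) * \prod_(0 <= k < n) g k <= boundary_ratio x v * \prod_(0 <= k < n) h k.
  rewrite -(ler_pM2r Hpos) -[leRHS]mulrA -full mulrAC [leRHS]mulrC.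
  by rewrite ler_wpM2r.
rewrite !big_mkord /g /h.
under eq_bigr do rewrite mulrACA -expr2.
under [X in _ <= _ * X]eq_bigr do rewrite exprMn.
by rewrite big_split [X in _ <= _ * X]big_split/= mulrCA [leRHS]mulrCA ler_pM2l// prodr_gt0.
Qed.

Lemma cvg_dyadic_scale (f : R -> R) c : f 0 = 0 -> is_derive (0 : R) 1 f 1 ->
  (2 ^+ r * f (c / 2 ^+ r) @[r --> \oo] --> c)%classic.
Proof.
move=> f0 [df f'1]; have [->|c0] := eqVneq c 0.
  under eq_fun do rewrite mul0r f0 mulr0; exact: cvg_cst.
have p2 r : 2 ^+ r != 0 :> R by rewrite expf_neq0.
have := df; rewrite /derivable => /cvg_ex[l dl].
have {f'1} l1 : l = 1 by rewrite -f'1 /derive; apply/esym/cvg_lim.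
have c_cvg : (c / 2 ^+ r @[r --> \oo] --> (0 : R))%classic.
  rewrite -[X in (_ --> X)%classic](mulr0 c); apply: cvgMr.
  under eq_fun do rewrite -exprVn.
  by apply: cvg_expr; rewrite ger0_norm ?invr_ge0// invf_lt1// ltr1n.
have c_neq0 r : c / 2 ^+ r != 0 by rewrite mulf_neq0// invr_neq0.
rewrite l1 in dl; have /(_ (fun r => c / 2 ^+ r) (conj c_neq0 c_cvg)) := (cvgr_dnbhsP _ _ _).1 dl.
move=> /(cvgMr (a := c)); rewrite mulr1; apply: cvg_trans.
apply: near_eq_cvg; apply: nearW => r /=.
by rewrite f0 subr0 addr0 /GRing.scale/= mulr1; field; rewrite c0 p2.
Qed.

Definition sinhR (b : R) : R := (expR b - expR (- b)) / 2.

Lemma coshR_sub1 (b : R) : coshR (b *+ 2) - 1 = 2 * sinhR b ^+ 2.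
Proof.
have e0 : expR b != 0 by rewrite gt_eqF// expR_gt0.
by rewrite /coshR /sinhR mulr2n opprD !expRD !expRN; field.
Qed.

Lemma is_derive_sinhR (b : R) : is_derive b 1 sinhR (coshR b).
Proof. by rewrite /sinhR; apply: is_derive_eq; rewrite /GRing.scale/= /coshR; lra. Qed.

Lemma sinhR_ge (b : R) : 0 <= b -> b <= sinhR b.
Proof.
move=> b0; have [c _ sE] : exists2 c, c \in `[0, b] & sinhR b - sinhR 0 = coshR c * (b - 0).
  apply: MVT_segment => // [c _|]; first exact: is_derive_sinhR.
  apply: continuous_subspaceT => c; apply: differentiable_continuous.
  by apply/derivable1_diffP; have d := is_derive_sinhR c; exact: ex_derive.
have s0 : sinhR 0 = 0 by rewrite /sinhR oppr0 subrr mul0r.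
move: sE; rewrite s0 !subr0 => ->.
by rewrite ler_peMl// coshR_ge1.
Qed.

Lemma sqr_ln_le (r : R) : 0 < r -> ln r ^+ 2 <= (r - 1) ^+ 2 / r.
Proof.
move=> r0; set u := ln r / 2; have uE : ln r = u *+ 2 by rewrite -mulr_natr divfK.
have -> : (r - 1) ^+ 2 / r = 2 * (coshR (ln r) - 1).
  by rewrite /coshR expRN lnK ?posrE//; field; rewrite gt_eqF.
rewrite uE coshR_sub1 mulr2n.
suff : u ^+ 2 <= sinhR u ^+ 2 by nra.
wlog u0 : u {uE} / 0 <= u => [h|].
  have [/h//|/ltW u0] := leP 0 u.
  have -> : sinhR u = - sinhR (- u) by rewrite /sinhR opprK; lra.
  by rewrite sqrrN -(sqrrN u) h// oppr_ge0.
by rewrite lerXn2r ?nnegrE ?sinhR_ge// (le_trans u0)// sinhR_ge.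
Qed.

Lemma cvg_sqr (u : nat -> R) (l : R) :
  (u r @[r --> \oo] --> l -> u r ^+ 2 @[r --> \oo] --> l ^+ 2)%classic.
Proof. by move=> ul; rewrite expr2; under eq_fun do rewrite expr2; exact: cvgM. Qed.

Lemma continuous_coshR : continuous (@coshR R).
Proof.
move=> b; apply: cvgMl; apply: cvgD; first exact: continuous_expR.
by apply: continuous_comp; [exact: opp_continuous|exact: continuous_expR].
Qed.

Lemma cvg_lattice_factor v t :
  ((2 ^+ r) ^+ 2 * lattice_factor r v t @[r --> \oo] -->
    2 * pi ^+ 2 * (t ^+ 2 + v ^+ 2))%classic.
Proof.
have -> : 2 * pi ^+ 2 * (t ^+ 2 + v ^+ 2) =
  2 * ((pi * v) ^+ 2 + (pi * t) ^+ 2) :> R by ring.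
have s0 : is_derive (0 : R) 1 sin 1 by apply: is_derive_eq; rewrite cos0.
have cs := @cvg_dyadic_scale sin (pi * t) (@sin0 R) s0.
have sh0 : sinhR 0 = 0 by rewrite /sinhR oppr0 subrr mul0r.
have d0 : is_derive (0 : R) 1 sinhR 1 by rewrite -[X in is_derive _ _ _ X](coshR0 R); exact: is_derive_sinhR.
have ch := @cvg_dyadic_scale sinhR (pi * v) sh0 d0.
have E r : (2 ^+ r) ^+ 2 * lattice_factor r v t =
  2 * ((2 ^+ r * sinhR (pi * v / 2 ^+ r)) ^+ 2 + (2 ^+ r * sin (pi * t / 2 ^+ r)) ^+ 2).
  rewrite /lattice_factor.
  have -> : coshR (2 * pi * v / 2 ^+ r) - cos (2 * pi * t / 2 ^+ r) =
    (coshR ((pi * v / 2 ^+ r) *+ 2) - 1) + (1 - cos (2 * pi * t / 2 ^+ r)).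
    by rewrite mulr2n (_ : 2 * pi * v / 2 ^+ r = pi * v / 2 ^+ r + pi * v / 2 ^+ r); ring.
  rewrite coshR_sub1 one_sub_cos.
  have -> : 2 * pi * t / 2 ^+ r / 2 = pi * t / 2 ^+ r :> R by field; rewrite expf_neq0.
  ring.
under eq_fun do rewrite E.
by apply: cvgMr; apply: cvgD; exact: cvg_sqr.
Qed.

Lemma boundary_estimate (n : nat) x v : (0 < n)%N -> 16 * x ^+ 2 <= n%:R ->
  (1 - 16 * x ^+ 2 / n%:R) *
    \prod_(k < n) (((k%:R + 2^-1 + x) ^+ 2 + v ^+ 2) * ((k%:R + 2^-1 - x) ^+ 2 + v ^+ 2)) <=
  boundary_ratio x v * \prod_(k < n) ((k%:R + 2^-1) ^+ 2 + v ^+ 2) ^+ 2.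
Proof.
move=> n0 xn; pose L t : R := 2 * pi ^+ 2 * (t ^+ 2 + v ^+ 2).
pose F r t := (2 ^+ r.+1) ^+ 2 * lattice_factor r.+1 v t.
have FL t : (F r t @[r --> \oo] --> L t)%classic.
  have := @cvg_lattice_factor v t.
  by rewrite -(cvg_shiftS (fun r => (2 ^+ r) ^+ 2 * lattice_factor r v t)).
have mulc : continuous (fun p : R * R => p.1 * p.2)%R by exact: mul_continuous.
have lim1 : (((1 - 16 * x ^+ 2 / n%:R) *
    \prod_(k < n) (F r (k%:R + 2^-1 + x) * F r (k%:R + 2^-1 - x)))%R @[r --> \oo] -->
    (1 - 16 * x ^+ 2 / n%:R) *
    \prod_(k < n) (L (k%:R + 2^-1 + x)%R * L (k%:R + 2^-1 - x)%R)%R)%classic.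
  by apply: cvgMr; apply: cvg_big => // k _; apply: cvgM; exact: FL.
have lim2 : ((boundary_ratio x v * \prod_(k < n) (F r (k%:R + 2^-1) ^+ 2))%R @[r --> \oo] -->
    boundary_ratio x v * \prod_(k < n) L (k%:R + 2^-1)%R ^+ 2)%classic.
  apply: cvgMr; apply: cvg_big => // k _; apply: cvg_sqr; exact: FL.
have c1 : (coshR (2 * pi * v / 2 ^+ r.+1) @[r --> \oo] --> (1 : R))%classic.
  have i0 : ((2 ^+ r.+1)^-1 @[r --> \oo] --> (0 : R))%classic.
    rewrite (cvg_shiftS (fun r => (2 ^+ r : R)^-1)); under eq_fun do rewrite -exprVn.
    by apply: cvg_expr; rewrite ger0_norm ?invr_ge0// invf_lt1// ltr1n.
  have h0 : (2 * pi * v / 2 ^+ r.+1 @[r --> \oo] --> (0 : R))%classic.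
    by have := cvgMr (a := 2 * pi * v) i0; rewrite mulr0; apply.
  have := @continuous_coshR 0; rewrite /continuous_at coshR0 => c0.
  exact: cvg_comp _ _ h0 c0.
have : (1 - 16 * x ^+ 2 / n%:R) *
    \prod_(k < n) (L (k%:R + 2^-1 + x) * L (k%:R + 2^-1 - x)) <=
    boundary_ratio x v * \prod_(k < n) L (k%:R + 2^-1) ^+ 2.
  rewrite -(cvg_lim _ lim1)// -(cvg_lim _ lim2)//.
  apply: ler_lim; [by apply/cvg_ex; eexists; exact: lim1
    |by apply/cvg_ex; eexists; exact: lim2|].
  have c2 : \forall r \near \oo%classic, coshR (2 * pi * v / 2 ^+ r.+1) <= 2.
    by apply: cvgr_le c1 _ _; lra.
  apply: filterS2 c2 (nbhs_infty_ge n) => r c2 /= nr0.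
  have nr : (n <= 2 ^ r)%N := leq_trans nr0 (ltnW (ltn_expl r (ltnSn 1))).
  have := lattice_boundary n0 xn nr c2.
  have p0 : 0 < \prod_(k < n) (2 ^+ r.+1 : R) ^+ 4 by rewrite prodr_gt0// => k _; rewrite !exprn_gt0.
  rewrite -(ler_pM2l p0) mulrCA [leRHS]mulrCA -!big_split/=.
  congr (_ * _ <= _ * _); apply: eq_bigr => k _; rewrite /F; ring.
rewrite /L.
under eq_bigr do rewrite mulrACA -expr2.
under [X in _ <= _ * X]eq_bigr do rewrite exprMn.
rewrite big_split [X in _ <= _ * X]big_split/= mulrCA [leRHS]mulrCA ler_pM2l// prodr_gt0// => k _.
by rewrite exprn_gt0// mulr_gt0// exprn_gt0// pi_gt0.
Qed.

End BoundaryLimit.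

Section ProductBound.
Variable R : realType.
Variables (a x y : R).
Hypothesis a_gt : 2^-1 < a.
Hypothesis x_gt0 : 0 < x.

Local Notation K := (16 * x ^+ 2).

Let num p : R[i] := (a + p) +i* y.
Let refl p : R[i] := (1 - a + p) +i* y.

Lemma sqr_normc_num p : normc (num p) ^+ 2 = (a + p) ^+ 2 + y ^+ 2.
Proof. exact: sqr_normcE. Qed.

Lemma sqr_normc_refl p : normc (refl p) ^+ 2 = (1 - a + p) ^+ 2 + y ^+ 2.
Proof. exact: sqr_normcE. Qed.

(* With [|s + i t| = 1], [z = (num 0 - refl 0 * w) / (1 - w)] lies on the line
   Re z = 1/2, at height [y + (a - 1/2) t / (1 - s)]. *)
Lemma half_plane_param p (s t : R) : s ^+ 2 + t ^+ 2 = 1 -> s != 1 ->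
  normc (num p - refl p * (s +i* t)) ^+ 2 =
  2 * (1 - s) * ((p + 2^-1) ^+ 2 + (y + (a - 2^-1) * t / (1 - s)) ^+ 2).
Proof.
move=> st s1.
have -> : num p - refl p * (s +i* t) =
  (a + p - ((1 - a + p) * s - y * t)) +i* (y - ((1 - a + p) * t + y * s)) by [].
rewrite sqr_normcE; have s1' : 1 - s != 0 by rewrite subr_eq0 eq_sym.
have st' : t ^+ 2 = 1 - s ^+ 2 by rewrite -st; ring.
apply: (mulIf s1'); rewrite [RHS](_ : _ =
  2 * ((1 - s) ^+ 2 * (p + 2^-1) ^+ 2 + (y * (1 - s) + (a - 2^-1) * t) ^+ 2)); last by field.
by field: st'.
Qed.

Lemma boundary_ratio_le1 v : boundary_ratio x v <= 1.
Proof.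
have := coshR_ge1 (2 * pi * v); have := cos_le1 (2 * pi * x) => c C.
by rewrite ler_pdivrMr; lra.
Qed.

Lemma boundary_ratio_ge0 v : 0 <= boundary_ratio x v.
Proof.
have := coshR_ge1 (2 * pi * v); have := cos_geN1 (2 * pi * x) => c C.
by rewrite divr_ge0; lra.
Qed.

Lemma ler_boundary_ratio v V : `|v| <= V -> boundary_ratio x v <= boundary_ratio x V.
Proof.
move=> vV; have C1 := coshR_ge1 (2 * pi * v); have c1 := cos_le1 (2 * pi * x).
have CV : coshR (2 * pi * v) <= coshR (2 * pi * V).
  apply: ler_coshR; rewrite normrM ger0_norm ?mulr_ge0 ?pi_ge0//.
  by rewrite ler_wpM2l// mulr_ge0 ?pi_ge0.
have p1 : 0 < coshR (2 * pi * v) + 1 by lra.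
have p2 : 0 < coshR (2 * pi * V) + 1 by lra.
by rewrite /boundary_ratio ler_pdivrMr// [leRHS]mulrAC ler_pdivlMr//; nra.
Qed.

Lemma unit_circle (w : R[i]) : normc w = 1 -> complex.Re w ^+ 2 + complex.Im w ^+ 2 = 1.
Proof. by case: w => s t w1; rewrite -sqr_normcE w1 expr1n. Qed.

Let N n w := \prod_(k < n) (normc (num (k%:R + x) - refl (k%:R + x) * w) ^+ 2 *
                            normc (num (k%:R - x) - refl (k%:R - x) * w) ^+ 2).
Let D n w := \prod_(k < n) (normc (num k%:R - refl k%:R * w) ^+ 2) ^+ 2.

Lemma circle_estimate n (s t : R) : (0 < n)%N -> K <= n%:R ->
  s ^+ 2 + t ^+ 2 = 1 -> s != 1 ->
  (1 - K / n%:R) * N n (s +i* t) <=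
  boundary_ratio x (y + (a - 2^-1) * t / (1 - s)) * D n (s +i* t).
Proof.
move=> n0 Kn st s1; set v := y + _.
have s_le1 : s < 1 by rewrite lt_neqAle s1/=; have := sqr_ge0 t; nra.
have := @boundary_estimate R n x v n0 Kn.
have p0 : 0 < \prod_(k < n) (2 * (1 - s)) ^+ 2.
  by rewrite prodr_gt0// => k _; rewrite exprn_gt0//; lra.
rewrite -(ler_pM2l p0) mulrCA [leRHS]mulrCA -!big_split/=.
congr (_ * _ <= _ * _); apply: eq_bigr => k _; rewrite !half_plane_param// -/v.
  rewrite -!(addrAC _ x) -!(addrAC _ (- x)).
  set P := _ + v ^+ 2; set Q := _ + v ^+ 2; ring.
by set P := _ + v ^+ 2; ring.
Qed.

Lemma N_ge0 n w : 0 <= N n w.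
Proof. by rewrite prodr_ge0// => k _; rewrite mulr_ge0 ?sqr_ge0. Qed.

Lemma D_ge0 n w : 0 <= D n w.
Proof. by rewrite prodr_ge0// => k _; rewrite sqr_ge0. Qed.

Lemma circle_estimate_le1 n w : (0 < n)%N -> K <= n%:R -> normc w = 1 ->
  (1 - K / n%:R) * N n w <= D n w.
Proof.
move=> n0 Kn; case: w => s t /unit_circle/= st.
have [s1|s1] := eqVneq s 1; last first.
  apply: le_trans (circle_estimate n0 Kn st s1) _.
  by rewrite -[leRHS]mul1r ler_wpM2r ?D_ge0 ?boundary_ratio_le1.
have t0 : t = 0.
  by apply/eqP; rewrite -sqrf_eq0; move: st; rewrite s1; move: (t ^+ 2) => ? ?; apply/eqP; lra.
have e p : normc (num p - refl p * (s +i* t)) ^+ 2 = (2 * a - 1) ^+ 2.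
  have -> : num p - refl p * (s +i* t) =
    (a + p - ((1 - a + p) * s - y * t)) +i* (y - ((1 - a + p) * t + y * s)) by [].
  by rewrite sqr_normcE s1 t0; ring.
have -> : N n (s +i* t) = D n (s +i* t) by apply: eq_bigr => k _; rewrite !e expr2.
by rewrite -[leRHS]mul1r ler_wpM2r ?D_ge0// gerBl divr_ge0// mulr_ge0// sqr_ge0.
Qed.

Let V := `|y| + (a - 2^-1).

Lemma circle_estimate_strict n w : (0 < n)%N -> K <= n%:R -> normc w = 1 ->
  complex.Re w <= 0 -> (1 - K / n%:R) * N n w <= boundary_ratio x V * D n w.
Proof.
move=> n0 Kn; case: w => s t /unit_circle/= st s0.
have s1 : s != 1 by rewrite lt_eqF//; lra.
apply: le_trans (circle_estimate n0 Kn st s1) _.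
rewrite ler_wpM2r ?D_ge0// ler_boundary_ratio// /V (le_trans (ler_normD _ _))// lerD2l.
have c0 : 0 <= a - 2^-1 by rewrite subr_ge0 ltW.
have sp : 0 < 1 - s by lra.
rewrite -mulrA normrM (ger0_norm c0) ler_piMr// normrM normfV (gtr0_norm sp).
rewrite ler_pdivrMr// mul1r (@le_trans _ _ 1)//; last lra.
by rewrite -(@expr_le1 _ 2)// -normrX ger0_norm ?sqr_ge0//; have := sqr_ge0 s; lra.
Qed.

Lemma circle_pair n w : (0 < n)%N -> K <= n%:R -> normc w = 1 ->
  (1 - K / n%:R) ^+ 2 * (N n w * N n (- w)) <= boundary_ratio x V * (D n w * D n (- w)).
Proof.
move=> n0 Kn w1.
wlog w0 : w w1 / complex.Re w <= 0 => [h|].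
  have [/h|w0] := leP (complex.Re w) 0; first exact.
  have := h (- w); rewrite normcN opprK w1 ![_ (- w) * _]mulrC; apply=> //.
  by case: w w0 {w1 h} => s t /=; lra.
have nw1 : normc (- w) = 1 by rewrite normcN.
have k0 : 0 <= 1 - K / n%:R.
  by rewrite subr_ge0 ler_pdivrMr ?mul1r// ltr0n.
rewrite expr2 mulrACA [leRHS]mulrA; apply: ler_pM; rewrite ?mulr_ge0 ?N_ge0//.
  exact: circle_estimate_strict.
exact: circle_estimate_le1.
Qed.

Lemma refl_half_neq0 : refl (- 2^-1) != 0.
Proof.
have : 0 < normc (refl (- 2^-1)) ^+ 2.
  rewrite sqr_normc_refl ltr_wpDr ?sqr_ge0// exprn_even_gt0//= lt_eqF//.
  by have := a_gt; lra.
by apply: contraTneq => ->; rewrite normc0 expr0n ltxx.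
Qed.

Lemma normc_unit_ratio : normc ((num (- 2^-1) / refl (- 2^-1)) ^+ 2) = 1.
Proof.
have r0 := refl_half_neq0.
rewrite normcX normcM normcV expr_div_n sqr_normc_num sqr_normc_refl.
have e : (1 - a + - 2^-1) ^+ 2 = (a + - 2^-1) ^+ 2 by field.
by rewrite e divff// -e -sqr_normc_refl sqrf_eq0 gt_eqF// normc_gt0.
Qed.

(* The maximum principle in the variable [w ^+ 2]: pairing [w] with [- w] keeps at least
   one of the two boundary points at height at most [V]. *)
Lemma product_max n : (0 < n)%N -> K < n%:R ->
  (1 - K / n%:R) * \prod_(k < n)
    (Num.max (normc (num (k%:R + x)) ^+ 2) (normc (refl (k%:R + x)) ^+ 2) *
     Num.max (normc (num (k%:R - x)) ^+ 2) (normc (refl (k%:R - x)) ^+ 2)) <=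
  Num.sqrt (boundary_ratio x V) * \prod_(k < n) (normc (num k%:R) ^+ 2) ^+ 2.
Proof.
move=> n0 Kn; have k0 : 0 < 1 - K / n%:R.
  by rewrite subr_gt0 ltr_pdivrMr ?mul1r// ltr0n.
pose I := ('I_n * bool)%type; pose arg (i : I) := i.1%:R + (if i.2 then x else - x).
have sq z : normc (z ^+ 2) = normc z ^+ 2 by rewrite normcX.
have pairE (F : R -> R) : \prod_(i : I) F (arg i) =
    \prod_(k < n) (F (k%:R + x) * F (k%:R - x)).
  rewrite -(pair_bigA _ (fun k b => F (arg (k, b))))/=.
  by apply: eq_bigr => k _; rewrite big_bool.
have constE (F : R -> R) : \prod_(i : I) F i.1%:R = \prod_(k < n) F k%:R ^+ 2.
  rewrite -(pair_bigA _ (fun (k : 'I_n) (b : bool) => F k%:R))/=.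
  by apply: eq_bigr => k _; rewrite big_bool expr2.
suff : \prod_(i : I) Num.max (normc (num (arg i) ^+ 2)) (normc (refl (arg i) ^+ 2)) <=
    Num.sqrt (boundary_ratio x V) / (1 - K / n%:R) * \prod_(i : I) normc (num i.1%:R ^+ 2).
  rewrite (pairE (fun p => Num.max (normc (num p ^+ 2)) (normc (refl p ^+ 2)))).
  rewrite (constE (fun p => normc (num p ^+ 2))) mulrAC ler_pdivlMr// mulrC.
  under eq_bigr do rewrite !sq.
  by under [X in _ <= _ * X]eq_bigr do rewrite !sq.
apply: (@max_modulus_prod R I (fun i => num (arg i) ^+ 2) (fun i => refl (arg i) ^+ 2)
  (fun i => num i.1%:R ^+ 2) (fun i => refl i.1%:R ^+ 2)
  ((num (- 2^-1) / refl (- 2^-1)) ^+ 2)).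
- by rewrite divr_ge0 ?sqrtr_ge0// ltW.
- exact: normc_unit_ratio.
- move=> i; rewrite !sq sqr_normc_num sqr_normc_refl.
  have [e|ne] := eqVneq (arg i) (- 2^-1); [right|left].
    rewrite e expr_div_n divfK// expf_neq0//.
    exact: refl_half_neq0.
  rewrite -subr_eq0 (_ : _ - _ = 4 * (a - 2^-1) * (arg i + 2^-1)); last by field.
  have ca : a - 2^-1 != 0 by rewrite subr_eq0 gt_eqF.
  by rewrite !mulf_neq0// addr_eq0.
- move=> i; rewrite !sq sqr_normc_num sqr_normc_refl lerD2r.
  rewrite -subr_ge0 (_ : _ - _ = 4 * (a - 2^-1) * (i.1%:R + 2^-1)); last by field.
  have ca : 0 <= a - 2^-1 by rewrite subr_ge0 ltW.
  have ci : 0 <= i.1%:R + 2^-1 :> R by rewrite addr_ge0.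
  by rewrite !mulr_ge0.
move=> w w1; pose z := sqrtc w.
have zw : z ^+ 2 = w by rewrite sqr_sqrtc.
have z1 : normc z = 1.
  by apply/eqP; rewrite -(@pexpr_eq1 _ _ 2) ?normc_ge0// -normcX zw w1.
have split p : normc (num p ^+ 2 - refl p ^+ 2 * w) =
    normc (num p - refl p * z) * normc (num p - refl p * (- z)).
  by rewrite -normcM -zw; congr normc; ring.
rewrite (pairE (fun p => normc (num p ^+ 2 - refl p ^+ 2 * w))).
rewrite (constE (fun p => normc (num p ^+ 2 - refl p ^+ 2 * w))).
rewrite mulrAC ler_pdivlMr// mulrC.
rewrite -(@ler_pXn2r _ 2)// ?nnegrE; last 2 first.
- by rewrite mulr_ge0 ?(ltW k0)// prodr_ge0// => k _; rewrite mulr_ge0 ?normc_ge0.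
- by rewrite mulr_ge0 ?sqrtr_ge0// prodr_ge0// => k _; rewrite sqr_ge0.
have := circle_pair n0 (ltW Kn) z1.
rewrite !exprMn sqr_sqrtr ?boundary_ratio_ge0//.
congr (_ * _ <= _ * _); rewrite /N /D -big_split/= -prodrXl;
  by apply: eq_bigr => k _; rewrite !split; ring.
Qed.

Lemma product_bound : exists q : R, [/\ 0 <= q, q < 1 & forall n, (0 < n)%N -> K < n%:R ->
  (1 - K / n%:R) * \prod_(k < n)
    (((a + k%:R + x) ^+ 2 + y ^+ 2) * ((a + k%:R - x) ^+ 2 + y ^+ 2)) <=
  q * \prod_(k < n) ((a + k%:R) ^+ 2 + y ^+ 2) ^+ 2].
Proof.
pose r := Num.sqrt (boundary_ratio x V).
have r0 : 0 <= r by exact: sqrtr_ge0.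
have r1 : r <= 1.
  by rewrite -(@ler_pXn2r _ 2)// ?nnegrE// expr1n sqr_sqrtr ?boundary_ratio_ge0 ?boundary_ratio_le1.
pose A := normc (num (- x)) ^+ 2; pose B := normc (refl (- x)) ^+ 2.
have [g [g0 gr AB]] : exists g, [/\ 0 <= g, g * r < 1 & A <= g * Num.max A B].
  have [x2|x2] := leP x 2^-1.
    exists 1; split=> //; last by rewrite mul1r le_max lexx.
    rewrite mul1r -(@ltr_pXn2r _ 2)// ?nnegrE// expr1n sqr_sqrtr ?boundary_ratio_ge0//.
    have C1 := coshR_ge1 (2 * pi * V).
    have p1 : 0 < coshR (2 * pi * V) + 1 by lra.
    rewrite ltr_pdivrMr// mul1r ltrD2l -subr_gt0.
    have px : 0 < 2 * pi * x by rewrite !mulr_gt0// pi_gt0.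
    apply: lt_le_trans (one_sub_cos_ge (ltW px) _).
      by rewrite divr_gt0// exprn_gt0.
    by have := @pi_gt0 R; nra.
  have ltAB : A < B.
    rewrite /A /B sqr_normc_num sqr_normc_refl ltrD2r -subr_gt0.
    rewrite (_ : _ - _ = 4 * (a - 2^-1) * (x - 2^-1)); last by field.
    by rewrite !mulr_gt0// subr_gt0.
  have A0 : 0 <= A by exact: sqr_ge0.
  have B0 : 0 < B by exact: le_lt_trans ltAB.
  exists (A / B); split; first by rewrite divr_ge0// ltW.
    have q1 : A / B < 1 by rewrite ltr_pdivrMr// mul1r.
    by apply: le_lt_trans q1; rewrite ler_piMr// divr_ge0// ltW.
  by rewrite max_r ?(ltW ltAB)// divfK// gt_eqF.
exists (g * r); split=> // [|n n0 Kn]; first by rewrite mulr_ge0.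
have := ler_wpM2l g0 (product_max n0 Kn); rewrite mulrCA [leRHS]mulrA.
under [X in _ <= _ * X -> _]eq_bigr do rewrite sqr_normc_num.
apply: le_trans.
have k0 : 0 < 1 - K / n%:R by rewrite subr_gt0 ltr_pdivrMr ?mul1r// ltr0n.
rewrite ler_wpM2l ?(ltW k0)//.
case: n n0 {Kn k0} => // n _; rewrite !big_ord_recl mulrA.
rewrite (_ : (nat_of_ord (@ord0 n))%:R = 0 :> R)// addr0 !add0r.
have mx p q' : p <= Num.max p q' :> R by rewrite le_max lexx.
have sn p : (a + p) ^+ 2 + y ^+ 2 = normc (num p) ^+ 2 by rewrite sqr_normc_num.
have nonneg p : 0 <= p ^+ 2 + y ^+ 2 by rewrite addr_ge0 ?sqr_ge0.
apply: ler_pM.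
- by rewrite mulr_ge0.
- by rewrite prodr_ge0// => k _; rewrite mulr_ge0.
- by rewrite !sn [leRHS]mulrCA; apply: ler_pM; rewrite ?sqr_ge0// mx.
- apply: ler_prod => k _; rewrite -!(addrA a) !sn mulr_ge0 ?sqr_ge0// andTb.
  by apply: ler_pM; rewrite ?sqr_ge0// mx.
Qed.

End ProductBound.

Section ImproperFTC.
Variable R : realType.
Notation mu := (@lebesgue_measure R).
Local Open Scope classical_set_scope.
Local Notation D := (`]0, +oo[ : set R).

Let E (n : nat) : set R := `[n.+2%:R^-1, n.+2%:R].

Lemma inv_nat2_gt0 n : 0 < n.+2%:R^-1 :> R. Proof. by rewrite invr_gt0. Qed.

Lemma inv_nat2_lt n : n.+2%:R^-1 < n.+2%:R :> R.
Proof. by rewrite invf_plt ?posrE// (@lt_trans _ _ 1) ?invf_lt1 ?ltr1n. Qed.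

Lemma exhaust_sub n : E n `<=` D.
Proof.
move=> t; rewrite /E/= !in_itv/= andbT => /andP[+ _].
exact: lt_le_trans (inv_nat2_gt0 n).
Qed.

Lemma exhaust_homo : {homo E : n m / (n <= m)%N >-> (n <= m)%O}.
Proof.
move=> n m nm; apply/subsetPset => t; rewrite /E/= !in_itv/= => /andP[nt tn].
rewrite (le_trans _ nt)/= ?(le_trans tn) ?ler_nat//.
by rewrite lef_pV2 ?posrE// ler_nat.
Qed.

Lemma exhaust_near t : D t -> \forall n \near \oo, E n t.
Proof.
rewrite /= in_itv/= andbT => t0.
have /cvgryPge/(_ (Num.max t t^-1)) := @cvgr_idn R.
apply: filterS => n; rewrite ge_max /E/= in_itv/= => /andP[tn tVn].
have nn2 : n%:R <= n.+2%:R :> R by rewrite ler_nat; lia.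
rewrite (le_trans tn nn2) andbT -[leRHS]invrK lef_pV2 ?posrE ?invr_gt0//.
exact: le_trans tVn nn2.
Qed.

Lemma exhaust_bigcup : \bigcup_n E n = D.
Proof.
apply/seteqP; split=> [t [n _ /exhaust_sub//]|t Dt].
by have [n _ /(_ n (leqnn n)) En] := exhaust_near Dt; exists n.
Qed.

Section Primitive.
Variables (F f : R -> R).
Hypothesis dF : forall t : R, 0 < t -> is_derive t 1 F (f t).
Hypothesis cf : forall t : R, 0 < t -> {for t, continuous f}.

Lemma measurable_pos_continuous : measurable_fun D f.
Proof.
apply: open_continuous_measurable_fun; first exact: interval_open.
by move=> t; rewrite inE/= in_itv/= andbT => /cf.
Qed.

Lemma integral_exhaust n :
  (\int[mu]_(t in E n) (f t)%:E = (F n.+2%:R - F n.+2%:R^-1)%:E)%E.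
Proof.
have pos (t : R) : n.+2%:R^-1 <= t -> 0 < t by exact: lt_le_trans (inv_nat2_gt0 n).
have cF (t : R) : 0 < t -> {for t, continuous F}.
  move=> t0; apply: differentiable_continuous; apply/derivable1_diffP.
  exact: (ex_derive (is_derive := dF t0)).
rewrite EFinB; apply: continuous_FTC2; first exact: inv_nat2_lt.
- apply: continuous_in_subspaceT => t; rewrite inE/= in_itv/= => /andP[/pos t0 _].
  exact: cf.
- split.
  + move=> t; rewrite in_itv/= => /andP[/ltW/pos t0 _].
    exact: (ex_derive (is_derive := dF t0)).
  + by apply: cvg_at_right_filter; apply: cF; exact: inv_nat2_gt0.
  + by apply: cvg_at_left_filter; apply: cF.
- move=> t; rewrite in_itv/= => /andP[/ltW/pos t0 _].
  by rewrite derive1E (derive_val (is_derive := dF t0)).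
Qed.

Lemma integrable_bounded_primitive (M : R) : (forall t : R, 0 < t -> 0 <= f t) ->
  (forall t : R, 0 < t -> `|F t| <= M) -> mu.-integrable D (EFin \o f).
Proof.
move=> f0 FM; apply/integrableP; split.
  by apply/measurable_EFinP; exact: measurable_pos_continuous.
have -> : (\int[mu]_(t in D) `|(EFin \o f) t| = \int[mu]_(t in D) (f t)%:E)%E.
  apply: eq_integral => t; rewrite inE/= in_itv/= andbT => t0.
  by rewrite ger0_norm// f0.
apply: (@le_lt_trans _ _ (M + M)%:E); last by rewrite ltry.
rewrite -exhaust_bigcup.
have mE i : measurable_fun (E i) (EFin \o f).
  apply/measurable_EFinP; apply: measurable_funS measurable_pos_continuous => //.
  exact: exhaust_sub.
have cv : (\int[mu]_(t in E n) (f t)%:E)%E @[n --> \oo] -->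
    (\int[mu]_(t in \bigcup_n E n) (f t)%:E)%E.
  apply: ge0_nondecreasing_set_cvg_integral => //; first exact: exhaust_homo.
    by move=> i; exact: measurable_itv.
  move=> i t /exhaust_sub; rewrite /= in_itv/= andbT lee_fin; exact: f0.
apply: (cvge_to_le cv).
apply: nearW => n; rewrite integral_exhaust lee_fin.
have := FM n.+2%:R (ltr0Sn _ _); have := FM _ (inv_nat2_gt0 n).
by rewrite !ler_norml => /andP[? ?] /andP[? ?]; lra.
Qed.

Lemma integral_primitive0 : mu.-integrable D (EFin \o f) ->
  F n.+2%:R @[n --> \oo] --> (0 : R) -> F n.+2%:R^-1 @[n --> \oo] --> (0 : R) ->
  \int[mu]_(t in D) f t = 0.
Proof.
move=> fi F1 F0.
have mf := measurable_pos_continuous.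
have cv : (\int[mu]_(t in D) ((EFin \o f) \_ (E n)) t)%E @[n --> \oo] -->
    (\int[mu]_(t in D) (f t)%:E)%E.
  have mD : measurable D by exact: measurable_itv.
  apply: (@dominated_cvg _ _ R mu D mD (fun n => (EFin \o f) \_ (E n)) (EFin \o f)
    (fun t => `|f t|%:E)).
  - move=> n; apply/measurable_restrict; [exact: measurable_itv|exact: mD|].
    by apply: measurable_funS mD _ _; [move=> ? []|apply/measurable_EFinP].
  - move=> t Dt; apply: cvg_near_cst.
    by apply: filterS (exhaust_near Dt) => n En; rewrite patchE mem_set.
  - by [].
  - by have := integrable_norm fi.
  - by move=> n t _; rewrite patchE; case: ifPn => _; rewrite ?abse0 ?lee_fin.
have cv0 : (\int[mu]_(t in D) ((EFin \o f) \_ (E n)) t)%E @[n --> \oo] --> 0%E.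
  under eq_fun => n.
    rewrite -integral_mkcondr (setIidr (@exhaust_sub n)) integral_exhaust.
    over.
  apply: cvg_EFin; first exact: nearW.
  by rewrite -[X in _ --> X](subr0 0); apply: cvgB.
by rewrite /Rintegral (cvg_unique _ cv cv0).
Qed.

End Primitive.
End ImproperFTC.

Section GammaKernel.
Variable R : realType.
Notation mu := (@lebesgue_measure R).
Local Open Scope classical_set_scope.
Local Notation D := (`]0, +oo[ : set R).
Implicit Types s t x y phi : R.

Definition gker s t : R := expR ((s - 1) * ln t - t).

(* The real and imaginary parts of Euler's integrand at [s + i y] are the cases
   [phi = 0] and [phi = pi / 2]. *)
Definition gosc s y phi t : R := gker s t * cos (y * ln t - phi).

Lemma gker_gt0 s t : 0 < gker s t.
Proof. exact: expR_gt0. Qed.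

Lemma gkerD s x t : gker (s + x) t = expR (x * ln t) * gker s t.
Proof. by rewrite /gker -expRD; congr expR; ring. Qed.

Lemma gkerS s t : 0 < t -> gker (s + 1) t = t * gker s t.
Proof. by move=> t0; rewrite gkerD mul1r lnK// posrE. Qed.

Lemma gosc00 s t : gosc s 0 0 t = gker s t.
Proof. by rewrite /gosc mul0r subr0 cos0 mulr1. Qed.

Lemma gosc_le s y phi t : `|gosc s y phi t| <= gker s t.
Proof.
by rewrite normrM gtr0_norm ?gker_gt0// ler_piMr ?cos_max// ltW// gker_gt0.
Qed.

Lemma is_derive_gker s t : 0 < t ->
  is_derive t 1 (gker s) (((s - 1) / t - 1) * gker s t).
Proof.
move=> t0; have dl := is_derive1_ln t0.
rewrite /gker; apply: is_derive_eq.
by rewrite /GRing.scale/= mulrC; congr (_ * _); ring.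
Qed.

Lemma is_derive_gosc s y phi t : 0 < t ->
  is_derive t 1 (gosc (s + 1) y phi)
    (s * gosc s y phi t - gosc (s + 1) y phi t - y * gosc s y (phi + pi / 2) t).
Proof.
move=> t0; have dl := is_derive1_ln t0; have dg := is_derive_gker (s + 1) t0.
have dc : is_derive t 1 (fun u => cos (y * ln u - phi)) (- sin (y * ln t - phi) * (y / t)).
  apply: is_derive_eq; rewrite /GRing.scale/=; ring.
rewrite {1}/gosc; apply: is_derive_eq.
rewrite /gosc /GRing.scale/= gkerS// opprD addrA cosBpihalf.
by field; rewrite gt_eqF.
Qed.

Lemma continuous_gosc s y phi t : 0 < t -> {for t, continuous (gosc s y phi)}.
Proof.
move=> t0; have := @is_derive_gosc (s - 1) y phi t t0; rewrite subrK => d.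
by apply: differentiable_continuous; apply/derivable1_diffP; exact: ex_derive.
Qed.

(* The tangent line of [ln] at [p]. *)
Lemma ln_tangent (p u : R) : 0 < p -> 0 < u -> p * ln u <= u - p + p * ln p.
Proof.
move=> p0 u0; have up : 0 < u / p by rewrite divr_gt0.
have : ln (u / p) <= u / p - 1.
  by rewrite -{1}[u / p](subrKC 1) le_ln1Dx// ltrBrDl subrr.
rewrite ln_div ?posrE// -(ler_pM2l p0) mulrBr mulrBr mulrCA divff ?gt_eqF//; lra.
Qed.

Lemma gker_bound s : 0 < s -> exists C, 0 < C /\ forall t, 0 < t -> gker (s + 1) t <= C.
Proof.
move=> s0; exists (expR (s * ln s - s)); split=> [|t t0]; first exact: expR_gt0.
by rewrite /gker addrK ler_expR; have := ln_tangent s0 t0; lra.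
Qed.

(* A bounded function whose derivative dominates [gker s] up to a constant. *)
Definition gdom s t : R := expR (s * (ln t - ln (1 + t))).

Lemma is_derive_gdom s t : 0 < t ->
  is_derive t 1 (gdom s) (s * gdom s t / (t * (1 + t))).
Proof.
move=> t0; have dl := is_derive1_ln t0.
have t10 : 0 < 1 + t by lra.
have dl1 := is_derive1_ln t10.
have d1 : is_derive t 1 (fun u : R => 1 + u) 1.
  by apply: is_derive_eq; lra.
have d2 : is_derive t 1 (fun u : R => ln (1 + u)) ((1 + t)^-1 * 1).
  exact: (@is_derive1_comp _ _ (fun u : R => 1 + u) _ _ _ dl1 d1).
rewrite /gdom; apply: is_derive_eq.
rewrite /GRing.scale/=; field.
by rewrite !gt_eqF.
Qed.

Lemma gdom_bound s t : 0 < s -> 0 < t -> `|gdom s t| <= 1.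
Proof.
move=> s0 t0; rewrite gtr0_norm ?expR_gt0// expR_le1 pmulr_rle0// subr_le0.
by rewrite ler_ln ?posrE; lra.
Qed.

Lemma gdom_ge s t : 0 < s -> 0 < t ->
  s * gker s t <= expR ((s + 1) * ln (s + 1) - s) * (s * gdom s t / (t * (1 + t))).
Proof.
move=> s0 t0; have t10 : 0 < 1 + t by lra.
have -> : s * gdom s t / (t * (1 + t)) =
    s * expR ((s - 1) * ln t - (s + 1) * ln (1 + t)).
  have -> : (t * (1 + t))^-1 = expR (- (ln t + ln (1 + t))).
    by rewrite expRN expRD !lnK ?posrE.
  by rewrite /gdom -mulrA -expRD; congr (_ * expR _); ring.
rewrite mulrCA ler_pM2l// -expRD ler_expR.
by have := @ln_tangent (s + 1) (1 + t) ltac:(lra) t10; lra.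
Qed.

Lemma integrable_gker s : 0 < s -> mu.-integrable D (EFin \o gker s).
Proof.
move=> s0; pose C := expR ((s + 1) * ln (s + 1) - s) / s.
have mD : measurable D by exact: measurable_itv.
have cgk t : 0 < t -> {for t, continuous (gker s)}.
  move=> t0; have := @continuous_gosc s 0 0 t t0.
  by rewrite (_ : gosc s 0 0 = gker s)//; apply/funext => u; rewrite gosc00.
have cdom t : 0 < t -> {for t, continuous (fun t => s * gdom s t / (t * (1 + t)))}.
  move=> t0; apply: continuousM; first apply: continuousM.
  - exact: cst_continuous.
  - have d := is_derive_gdom s t0.
    by apply: differentiable_continuous; apply/derivable1_diffP; exact: ex_derive.
  - apply: continuousV; first by rewrite mulf_neq0// gt_eqF//; lra.
    apply: continuousM; first exact: cvg_id.
    by apply: continuousD; [exact: cst_continuous|exact: cvg_id].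
have dom0 t : 0 < t -> 0 <= s * gdom s t / (t * (1 + t)).
  by move=> t0; rewrite divr_ge0// mulr_ge0 ?ltW ?expR_gt0//; lra.
have di := integrable_bounded_primitive (@is_derive_gdom s) cdom dom0 (@gdom_bound s ^~ s0).
apply: (@le_integrable _ _ R mu D mD _
  (fun t => C%:E * (EFin \o (fun t => (s * gdom s t / (t * (1 + t)))%R)) t)%E).
- by apply/measurable_EFinP; exact: measurable_pos_continuous cgk.
- move=> t /=; rewrite in_itv/= andbT => t0; rewrite lee_fin.
rewrite gtr0_norm ?gker_gt0// ger0_norm; last first.
  by rewrite mulr_ge0 ?dom0// divr_ge0 ?expR_ge0// ltW.
rewrite -(ler_pM2l s0) /C mulrA (_ : s * (_ / s) = expR ((s + 1) * ln (s + 1) - s)).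
    exact: gdom_ge.
  by rewrite mulrC divfK// gt_eqF.
- by apply: integrableZl => //; exact: di.
Qed.

Lemma integrable_gosc s y phi : 0 < s -> mu.-integrable D (EFin \o gosc s y phi).
Proof.
move=> s0; have mD : measurable D by exact: measurable_itv.
apply: (@le_integrable _ _ R mu D mD _ (EFin \o gker s)).
- by apply/measurable_EFinP; apply: measurable_pos_continuous; exact: continuous_gosc.
- move=> t _; rewrite lee_fin (le_trans (gosc_le _ _ _ _))//; exact: ler_norm.
- exact: integrable_gker.
Qed.

End GammaKernel.

Section GammaIntegral.
Variable R : realType.
Notation mu := (@lebesgue_measure R).
Local Open Scope classical_set_scope.
Local Notation D := (`]0, +oo[ : set R).
Implicit Types s t x y phi : R.

Definition Gosc s y phi : R := \int[mu]_(t in D) gosc s y phi t.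

Definition Gam s : R := \int[mu]_(t in D) gker s t.

Lemma Gosc00 s : Gosc s 0 0 = Gam s.
Proof. by apply: eq_Rintegral => t _; rewrite gosc00. Qed.

Lemma pos_of_itv0y t : D t -> 0 < t.
Proof. by rewrite /= in_itv/= andbT. Qed.

Lemma Gam_ge0 s : 0 <= Gam s.
Proof. by apply: Rintegral_ge0 => t _; rewrite ltW// gker_gt0. Qed.

Lemma cvg_inv_nat2 : (n.+2%:R^-1 : R) @[n --> \oo] --> (0 : R).
Proof.
by have := @cvg_harmonic R; rewrite -(cvg_shiftS (fun n => n.+1%:R^-1 : R)).
Qed.

Lemma integrable_scale (f : R -> R) (k : R) :
  mu.-integrable D (EFin \o f) -> mu.-integrable D (EFin \o (fun t => k * f t)).
Proof. by move=> fi; apply: (@integrableZl _ _ R mu D _ k (EFin \o f)). Qed.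

Lemma integrable_add (f g : R -> R) :
  mu.-integrable D (EFin \o f) -> mu.-integrable D (EFin \o g) ->
  mu.-integrable D (EFin \o (fun t => f t + g t)).
Proof. by move=> fi gi; apply: (@integrableD _ _ R mu D _ (EFin \o f) (EFin \o g)). Qed.

Lemma integrable_sub (f g : R -> R) :
  mu.-integrable D (EFin \o f) -> mu.-integrable D (EFin \o g) ->
  mu.-integrable D (EFin \o (fun t => f t - g t)).
Proof. by move=> fi gi; apply: (@integrableB _ _ R mu D _ (EFin \o f) (EFin \o g)). Qed.

Lemma gosc_vanish_y s y phi : 0 < s -> gosc (s + 1) y phi n.+2%:R @[n --> \oo] --> (0 : R).
Proof.
move=> s0; have [C [C0 HC]] : exists C : R, 0 < C /\ forall t : R, 0 < t -> gker (s + 1 + 1) t <= C.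
  by apply: gker_bound; lra.
have h : C * n.+2%:R^-1 @[n --> \oo] --> (0 : R).
  rewrite -[X in _ --> X](mulr0 C); apply: cvgMr.
  exact: cvg_inv_nat2.
apply/norm_cvg0P.
apply: (squeeze_cvgr _ (cvg_cst 0) h); apply: nearW => n; rewrite normr_ge0/=.
apply: le_trans (gosc_le _ _ _ _) _.
by rewrite ler_pdivlMr// mulrC -gkerS// HC.
Qed.

Lemma gosc_vanish_0 s y phi : 0 < s -> gosc (s + 1) y phi n.+2%:R^-1 @[n --> \oo] --> (0 : R).
Proof.
move=> s0; apply/norm_cvg0P.
have h : n.+2%:R^-1 `^ s @[n --> \oo] --> (0 : R).
  have /cvg_at_rightP := powR_cvg0 s0; apply.
  by split=> [n|]; [rewrite invr_gt0|exact: cvg_inv_nat2].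
apply: (squeeze_cvgr _ (cvg_cst 0) h); apply: nearW => n; rewrite normr_ge0/=.
apply: le_trans (gosc_le _ _ _ _) _.
rewrite /gker addrK /powR gt_eqF ?invr_gt0//= ler_expR gerBl.
by rewrite invr_ge0.
Qed.

Lemma GoscS s y phi : 0 < s ->
  Gosc (s + 1) y phi = s * Gosc s y phi - y * Gosc s y (phi + pi / 2).
Proof.
move=> s0; have s10 : 0 < s + 1 by lra.
have i1 := integrable_gosc y phi s0.
have i2 := integrable_gosc y phi s10.
have i3 := integrable_gosc y (phi + pi / 2) s0.
have mD : measurable D by exact: measurable_itv.
have j1 : mu.-integrable D (EFin \o (fun t => s * gosc s y phi t)) by exact: integrable_scale.
have j3 : mu.-integrable D (EFin \o (fun t => y * gosc s y (phi + pi / 2) t)).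
  exact: integrable_scale.
have j12 : mu.-integrable D (EFin \o (fun t => s * gosc s y phi t - gosc (s + 1) y phi t)).
  exact: integrable_sub.
have j : mu.-integrable D (EFin \o (fun t => s * gosc s y phi t - gosc (s + 1) y phi t -
    y * gosc s y (phi + pi / 2) t)).
  exact: integrable_sub.
have := @integral_primitive0 R (gosc (s + 1) y phi) _ (@is_derive_gosc R s y phi)
  _ j (gosc_vanish_y y phi s0) (gosc_vanish_0 y phi s0).
rewrite RintegralB// RintegralB// !RintegralZl// -!/(Gosc _ _ _) => H.
suff : s * Gosc s y phi - Gosc (s + 1) y phi - y * Gosc s y (phi + pi / 2) = 0.
  by move: (Gosc _ _ _) (Gosc _ _ _) (Gosc _ _ _) => u v w; lra.
apply: H => t t0; apply: cvgB; first apply: cvgB; try apply: cvgMr; exact: continuous_gosc.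
Qed.

Lemma GamS s : 0 < s -> Gam (s + 1) = s * Gam s.
Proof. by move=> s0; rewrite -!Gosc00 GoscS// mul0r subr0. Qed.

Lemma Gosc_combine s y (p q : R) : 0 < s ->
  p * Gosc s y 0 + q * Gosc s y (pi / 2) =
  \int[mu]_(t in D) (gker s t * (p * cos (y * ln t) + q * sin (y * ln t))) /\
  mu.-integrable D
    (EFin \o (fun t => gker s t * (p * cos (y * ln t) + q * sin (y * ln t)))).
Proof.
move=> s0; have i1 := integrable_gosc y 0 s0; have i2 := integrable_gosc y (pi / 2) s0.
have mD : measurable D by exact: measurable_itv.
have j1 : mu.-integrable D (EFin \o (fun t => p * gosc s y 0 t)) by exact: integrable_scale.
have j2 : mu.-integrable D (EFin \o (fun t => q * gosc s y (pi / 2) t)).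
  exact: integrable_scale.
have e : (fun t => gker s t * (p * cos (y * ln t) + q * sin (y * ln t))) =
    (fun t => p * gosc s y 0 t + q * gosc s y (pi / 2) t).
  by apply/funext => t; rewrite /gosc subr0 cosBpihalf; ring.
rewrite e -!RintegralZl// -RintegralD//; split=> //; exact: integrable_add.
Qed.

Lemma Gosc_rot s y phi : 0 < s ->
  Gosc s y phi = cos phi * Gosc s y 0 + sin phi * Gosc s y (pi / 2).
Proof.
move=> s0; have [-> _] := Gosc_combine y (cos phi) (sin phi) s0.
by apply: eq_Rintegral => t _; rewrite /gosc cosB; ring.
Qed.

Lemma Gosc_norm_le s y : 0 < s -> Gosc s y 0 ^+ 2 + Gosc s y (pi / 2) ^+ 2 <= Gam s ^+ 2.
Proof.
move=> s0; set p := Gosc s y 0; set q := Gosc s y (pi / 2).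
pose r := Num.sqrt (p ^+ 2 + q ^+ 2).
have r0 : 0 <= r by exact: sqrtr_ge0.
have rE : r ^+ 2 = p ^+ 2 + q ^+ 2 by rewrite sqr_sqrtr// addr_ge0 ?sqr_ge0.
have [e i] := Gosc_combine y p q s0; have ig := integrable_gker s0.
have rG : r ^+ 2 <= r * Gam s.
  have mD : measurable D by exact: measurable_itv.
  rewrite rE !expr2 [leLHS]e -RintegralZl//.
  apply: le_Rintegral => //; first exact: integrable_scale.
  move=> t _; rewrite mulrC ler_pM2r ?gker_gt0//.
  have := cos2Dsin2 (y * ln t); move: (cos _) (sin _) => c d cd.
  rewrite (le_trans (ler_norm _))// -(@ler_pXn2r _ 2)// ?nnegrE// real_normK ?num_real//.
  by rewrite rE; have := sqr_ge0 (p * d - q * c); nra.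
rewrite -rE; have [->|rn] := eqVneq r 0; first by rewrite expr0n sqr_ge0.
have rp : 0 < r by rewrite lt_def rn.
by rewrite lerXn2r ?nnegrE ?Gam_ge0//; move: rG; rewrite expr2 ler_pM2l.
Qed.

Lemma Gam_cauchy s x : 0 < s - x -> 0 < s + x -> Gam s ^+ 2 <= Gam (s + x) * Gam (s - x).
Proof.
move=> s1 s2; have s0 : 0 < s by lra.
have mD : measurable D by exact: measurable_itv.
have key (l : R) : 0 <= Gam (s - x) - 2 * l * Gam s + l ^+ 2 * Gam (s + x).
  have i0 := integrable_gker s0; have i1 := integrable_gker s1; have i2 := integrable_gker s2.
  have j0 : mu.-integrable D (EFin \o (fun t => 2 * l * gker s t)) by exact: integrable_scale.
  have j2 : mu.-integrable D (EFin \o (fun t => l ^+ 2 * gker (s + x) t)).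
    exact: integrable_scale.
  have j01 : mu.-integrable D (EFin \o (fun t => gker (s - x) t - 2 * l * gker s t)).
    exact: integrable_sub.
  rewrite -!RintegralZl// -RintegralB// -RintegralD//.
  apply: Rintegral_ge0 => t Dt; set e := expR (x / 2 * ln t).
  have -> : gker (s - x) t - 2 * l * gker s t + l ^+ 2 * gker (s + x) t =
      gker (s - x) t * (1 - l * e ^+ 2) ^+ 2.
    have e2 : e ^+ 2 = expR (x * ln t) by rewrite /e -expRM_natl; congr expR; field.
    have g2 : gker (s + x) t = e ^+ 2 * gker s t by rewrite gkerD e2.
    have g1 : gker s t = e ^+ 2 * gker (s - x) t by have := gkerD (s - x) x t; rewrite subrK e2.
    rewrite g2 g1; ring.
  by rewrite mulr_ge0 ?sqr_ge0// ltW// gker_gt0.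
move: (Gam_ge0 (s + x)) key; move: (Gam (s + x)) (Gam (s - x)) (Gam s) => P Q S P0 key.
have [Z|Z] := eqVneq P 0.
  have := key ((Q + 1) / (2 * S)).
  have [->|S0] := eqVneq S 0; first by rewrite Z expr0n !mul0r.
  rewrite Z (_ : 2 * (_ / _) * _ = Q + 1); first lra.
  by field.
have P1 : 0 < P by rewrite lt_def Z.
have := key (S / P).
rewrite (_ : _ + _ = (P * Q - S ^+ 2) / P); last by field.
by rewrite pmulr_lge0 ?invr_gt0// subr_ge0.
Qed.

Lemma Gam_gt0 s : 0 < s -> 0 < Gam s.
Proof.
move=> s0; pose c := expR (- `|s - 1| - 2).
have c0 : 0 < c by exact: expR_gt0.
have gE : (\int[mu]_(t in D) (gker s t)%:E)%E = (Gam s)%:E.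
  by rewrite /Gam /Rintegral fineK// integrable_fin_num//; exact: integrable_gker.
rewrite -lte_fin -gE.
have mg : measurable_fun D (EFin \o gker s) by have /integrableP[] := integrable_gker s0.
pose I : set R := `[1, 2].
have sub : I `<=` D.
  by move=> t; rewrite /I/= !in_itv/= andbT => /andP[t1 _]; lra.
have mI : measurable I by exact: measurable_itv.
have mD : measurable D by exact: measurable_itv.
suff low : (0 < \int[mu]_(t in I) (gker s t)%:E)%E.
  apply: (lt_le_trans low).
  apply: ge0_subset_integral => //.
  by move=> t _; rewrite lee_fin ltW// gker_gt0.
have cst0 : (0 < \int[mu]_(t in I) c%:E)%E.
  rewrite integral_cst//= lebesgue_measure_itv/= lte_fin ltr1n/=.
  by rewrite -EFinB -EFinM lte_fin mulr_gt0//; lra.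
apply: (lt_le_trans cst0); apply: ge0_le_integral => //; try by move=> t _; rewrite lee_fin ltW// gker_gt0.
- exact: measurable_funS mD sub mg.
- move=> t; rewrite /I/= in_itv/= => /andP[t1 t2]; rewrite lee_fin ler_expR.
  have l0 := ln_ge0 t1.
  have l1 : ln t <= 1 by have := @ln_tangent R 1 t ltr01 ltac:(lra); rewrite ln1; lra.
  have : - `|s - 1| <= (s - 1) * ln t.
    rewrite lerNl -mulNr (le_trans (ler_norm _))// normrM normrN ler_piMr//.
    by rewrite ger0_norm.
  lra.
Qed.

Lemma Gosc_ge s y : 1 < s -> (1 - y ^+ 2 / (2 * (s - 1))) * Gam s <= Gosc s y (y * ln s).
Proof.
move=> s1; have s0 : 0 < s by lra.
have sm0 : 0 < s - 1 by lra.
have sp0 : 0 < s + 1 by lra.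
have mD : measurable D by exact: measurable_itv.
have i0 := integrable_gker s0; have i1 := integrable_gker sm0; have i2 := integrable_gker sp0.
pose c := y ^+ 2 / (2 * s).
have E : (1 - y ^+ 2 / (2 * (s - 1))) * Gam s =
    (1 + 2 * c * s) * Gam s - c * Gam (s + 1) - c * s ^+ 2 * Gam (s - 1).
  have := GamS sm0; rewrite subrK GamS// => ->; rewrite /c; field.
  by rewrite !gt_eqF.
have j0 : mu.-integrable D (EFin \o (fun t => (1 + 2 * c * s) * gker s t)).
  exact: integrable_scale.
have j1 : mu.-integrable D (EFin \o (fun t => c * s ^+ 2 * gker (s - 1) t)).
  exact: integrable_scale.
have j2 : mu.-integrable D (EFin \o (fun t => c * gker (s + 1) t)).
  exact: integrable_scale.
have j02 : mu.-integrable D (EFin \o (fun t => (1 + 2 * c * s) * gker s t - c * gker (s + 1) t)).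
  exact: integrable_sub.
rewrite E -!RintegralZl// -RintegralB// -RintegralB//.
apply: le_Rintegral => //; [exact: integrable_sub|exact: integrable_gosc|].
move=> t /pos_of_itv0y t0; rewrite gkerS//.
have := gkerS (s - 1) t0; rewrite subrK => gE; rewrite /gosc gE.
have cosE : 1 - y ^+ 2 * ln (t / s) ^+ 2 / 2 <= cos (y * ln t - y * ln s).
  rewrite -mulrBr -ln_div ?posrE//.
  by have := one_sub_cos_le (y * ln (t / s)); rewrite exprMn; lra.
have ts0 : 0 < t / s by rewrite divr_gt0.
have L := sqr_ln_le ts0.
have L2 : y ^+ 2 * ln (t / s) ^+ 2 / 2 <= c * (t - s) ^+ 2 / t.
  rewrite (_ : c * (t - s) ^+ 2 / t = y ^+ 2 * ((t / s - 1) ^+ 2 / (t / s)) / 2).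
    by rewrite ler_pM2r// ler_wpM2l// sqr_ge0.
  by rewrite /c; field; rewrite !gt_eqF.
have g0 := gker_gt0 (s - 1) t.
apply: (@le_trans _ _ (t * gker (s - 1) t * (1 - c * (t - s) ^+ 2 / t))).
  rewrite le_eqVlt; apply/orP; left; apply/eqP; field.
  by rewrite gt_eqF.
by rewrite ler_pM2l ?mulr_gt0//; lra.
Qed.

End GammaIntegral.

Section GammaModulus.
Variable R : realType.
Implicit Types (a s x y : R) (z : R[i]).

Lemma addc_nat s y n : (s +i* y) + n%:R = (s + n%:R) +i* y.
Proof. by rewrite -(rmorph_nat (real_complex R))/= -[LHS]/(_ +i* _) addr0. Qed.

Lemma Euler_GammaE s y : Euler_Gamma (s +i* y) = Gosc s y 0 +i* Gosc s y (pi / 2).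
Proof.
have e t : Gamma_integrand (s +i* y) t = gosc s y 0 t +i* gosc s y (pi / 2) t.
  rewrite /Gamma_integrand /gosc subr0 cosBpihalf /gker expRD.
  have -> : (s +i* y - 1) * (ln t)%:C = ((s - 1) * ln t) +i* (y * ln t).
    by rewrite -[LHS]/(_ +i* _); congr (_ +i* _); ring.
  by rewrite -[LHS]/(_ +i* _); congr (_ +i* _); ring.
by rewrite /Euler_Gamma; congr (_ +i* _); apply: eq_Rintegral => t _; rewrite e.
Qed.

Lemma Euler_GammaS z : 0 < complex.Re z -> Euler_Gamma (z + 1) = z * Euler_Gamma z.
Proof.
case: z => s y /= s0; rewrite -[1]/(1%:R) addc_nat !Euler_GammaE !GoscS// add0r.
rewrite (Gosc_rot y (pi / 2 + pi / 2) s0) (_ : pi / 2 + pi / 2 = pi); last by field.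
rewrite cospi sinpi -[RHS]/(_ +i* _); congr (_ +i* _); ring.
Qed.

Lemma Euler_Gamma_addn z n : 0 < complex.Re z ->
  Euler_Gamma (z + n%:R) = \prod_(k < n) (z + k%:R) * Euler_Gamma z.
Proof.
move=> z0; elim: n => [|n IH]; first by rewrite big_ord0 addr0 mul1r.
rewrite -natr1 addrA Euler_GammaS; last first.
  by case: z z0 {IH} => s y /= s0; rewrite addc_nat/= ltr_wpDr.
by rewrite IH big_ord_recr/= mulrA [(z + n%:R) * _]mulrC.
Qed.

Lemma Gamma_mul_prod z n : ~ Gamma_pole z -> (Gamma_shift z <= n)%N ->
  Gamma z * \prod_(k < n) (z + k%:R) = Euler_Gamma (z + n%:R).
Proof.
move=> np mn; have p0 : \prod_(k < Gamma_shift z) (z + k%:R) != 0.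
  by apply/eqP => /Gamma_poleE.
rewrite -(subnKC mn) natrD addrA Euler_Gamma_addn ?Re_Gamma_shift_gt0//.
rewrite /Gamma big_split_ord/= mulrA divfK// mulrC; congr (_ * _).
by apply: eq_bigr => k _; rewrite natrD addrA.
Qed.

Lemma normc_Euler_Gamma_le s y : 0 < s -> normc (Euler_Gamma (s +i* y)) <= Gam s.
Proof.
move=> s0; rewrite Euler_GammaE -(@ler_pXn2r _ 2)// ?nnegrE ?normc_ge0 ?Gam_ge0//.
by rewrite sqr_normcE Gosc_norm_le.
Qed.

Lemma normc_Euler_Gamma_ge s y : 1 < s ->
  (1 - y ^+ 2 / (2 * (s - 1))) * Gam s <= normc (Euler_Gamma (s +i* y)).
Proof.
move=> s1; have s0 : 0 < s by lra.
apply: le_trans (Gosc_ge y s1) _; rewrite Gosc_rot// Euler_GammaE.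
have [h|h] := leP (cos (y * ln s) * Gosc s y 0 + sin (y * ln s) * Gosc s y (pi / 2)) 0.
  exact: le_trans h (normc_ge0 _).
rewrite -(@ler_pXn2r _ 2)// ?nnegrE ?normc_ge0 ?(ltW h)// sqr_normcE.
have := cos2Dsin2 (y * ln s); move: (cos _) (sin _) (Gosc s y 0) (Gosc s y (pi / 2)) => c d p q cd.
have -> : p ^+ 2 + q ^+ 2 = (c * p + d * q) ^+ 2 + (p * d - q * c) ^+ 2.
  by rewrite -[LHS]mul1r -cd; ring.
by rewrite lerDl sqr_ge0.
Qed.

Lemma normc_Euler_Gamma_gt0 s y : 1 < s -> y ^+ 2 < 2 * (s - 1) ->
  0 < normc (Euler_Gamma (s +i* y)).
Proof.
move=> s1 ys; apply: lt_le_trans (normc_Euler_Gamma_ge y s1).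
have p0 : 0 < 2 * (s - 1) by lra.
by rewrite mulr_gt0 ?Gam_gt0// ?subr_gt0 ?ltr_pdivrMr ?mul1r//; lra.
Qed.

Lemma normc_Euler_Gamma_sqr_le s x y e : 0 < x -> 1 < s - x ->
  y ^+ 2 <= e * (2 * (s - x - 1)) -> e <= 1 ->
  (1 - e) ^+ 2 * normc (Euler_Gamma (s +i* y)) ^+ 2 <=
  normc (Euler_Gamma ((s + x) +i* y)) * normc (Euler_Gamma ((s - x) -i* y)).
Proof.
move=> x0 sx ye e1; have s0 : 0 < s by lra.
have sx0 : 0 < s - x by lra.
have sx1 : 0 < s + x by lra.
have e0 : 0 <= e.
  by rewrite -(@pmulr_lge0 _ (2 * (s - x - 1))); [apply: le_trans ye; exact: sqr_ge0|lra].
have low t u : s - x <= t -> u ^+ 2 = y ^+ 2 ->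
    (1 - e) * Gam t <= normc (Euler_Gamma (t +i* u)).
  move=> st uy; have t1 : 1 < t by lra.
  apply: le_trans (normc_Euler_Gamma_ge u t1); rewrite ler_wpM2r ?Gam_ge0//.
  rewrite lerD2l lerN2 uy ler_pdivrMr; last by lra.
  by apply: le_trans ye _; rewrite ler_wpM2l//; lra.
have up : normc (Euler_Gamma (s +i* y)) ^+ 2 <= Gam (s + x) * Gam (s - x).
  apply: le_trans (Gam_cauchy sx0 sx1).
  by rewrite lerXn2r ?nnegrE ?normc_ge0 ?Gam_ge0// normc_Euler_Gamma_le.
apply: (@le_trans _ _ (((1 - e) * Gam (s + x)) * ((1 - e) * Gam (s - x)))).
  by rewrite [leRHS]mulrACA -(expr2 (1 - e)) ler_wpM2l ?sqr_ge0.
by apply: ler_pM; rewrite ?mulr_ge0 ?Gam_ge0 ?subr_ge0// low ?sqrrN//; lra.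
Qed.

Lemma normc_Gamma_lt a x y : 2^-1 < a -> 0 < x -> ~ Gamma_pole ((a - x) -i* y) ->
  normc (Gamma (a +i* y)) ^+ 2 <
  normc (Gamma ((a + x) +i* y)) * normc (Gamma ((a - x) -i* y)).
Proof.
move=> a_gt x0 np2.
have np s u : 0 < s -> ~ Gamma_pole (s +i* u).
  move=> s0 [k /eqP]; rewrite -(rmorph_nat (real_complex R)) eq_complex/= => /andP[/eqP sk _].
  by have := ler0n R k; lra.
have [q [q0 q1 Hq]] := @product_bound R a x y a_gt x0.
pose e := (1 - q) / 6; have e0 : 0 < e by rewrite /e; lra.
have e1 : e < 1 by rewrite /e; lra.
pose K := 16 * x ^+ 2; have K0 : 0 <= K by rewrite mulr_ge0// sqr_ge0.
have ye0 : 0 <= y ^+ 2 / e by rewrite divr_ge0 ?sqr_ge0// ltW.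
have Ke0 : 0 <= K / e by rewrite divr_ge0// ltW.
pose T := K / e + y ^+ 2 / e + x + 2 + K.
have T0 : 0 <= T by rewrite /T; lra.
pose z0 := a +i* y; pose z1 := (a + x) +i* y; pose z2 := (a - x) -i* y.
have [n [nT s0 s1 s2]] : exists n, [/\ T < n%:R, (Gamma_shift z0 <= n)%N,
    (Gamma_shift z1 <= n)%N & (Gamma_shift z2 <= n)%N].
  exists (maxn (Num.bound T) (maxn (Gamma_shift z0) (maxn (Gamma_shift z1) (Gamma_shift z2)))).
  rewrite !leq_max !leqnn !orbT; split=> //.
  by apply: lt_le_trans (archi_boundP T0) _; rewrite ler_nat leq_maxl.
have n1 : 0 < n%:R :> R by lra.
have n0 : (0 < n)%N by rewrite -(ltr0n R).
have nK : K < n%:R by move: nT; rewrite /T; lra.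
have {Hq} := Hq n n0 nK; rewrite -/K => Hq.
have Kn : K / n%:R <= e.
  rewrite ler_pdivrMr// mulrC -ler_pdivrMr//; move: nT; rewrite /T; lra.
have yn : y ^+ 2 <= e * (2 * (a + n%:R - x - 1)).
  rewrite mulrC -ler_pdivrMr//; move: nT; rewrite /T; lra.
have sx : 1 < a + n%:R - x by move: nT; rewrite /T; lra.
have := normc_Euler_Gamma_sqr_le x0 sx yn (ltW e1).
have E0 : normc (Euler_Gamma ((a + n%:R) +i* y)) =
    normc (Gamma z0) * \prod_(k < n) normc (z0 + k%:R).
  by rewrite -normc_prod -normcM Gamma_mul_prod ?addc_nat//; apply: np; lra.
have E1 : normc (Euler_Gamma ((a + n%:R + x) +i* y)) =
    normc (Gamma z1) * \prod_(k < n) normc (z1 + k%:R).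
  rewrite -normc_prod -normcM Gamma_mul_prod ?addc_nat//; last by apply: np; lra.
  by rewrite addrAC.
have E2 : normc (Euler_Gamma ((a + n%:R - x) -i* y)) =
    normc (Gamma z2) * \prod_(k < n) normc (z2 + k%:R).
  by rewrite -normc_prod -normcM Gamma_mul_prod ?addc_nat// addrAC.
have pos : 0 < normc (Euler_Gamma ((a + n%:R + x) +i* y)) *
    normc (Euler_Gamma ((a + n%:R - x) -i* y)).
  apply: lt_le_trans (normc_Euler_Gamma_sqr_le x0 sx yn (ltW e1)).
  have s1' : 1 < a + n%:R by lra.
  have ys : y ^+ 2 < 2 * (a + n%:R - 1).
    have m0 : 0 < 2 * (a + n%:R - x - 1) by lra.
    by apply: le_lt_trans yn _; rewrite (@lt_trans _ _ (2 * (a + n%:R - x - 1)))// ?gtr_pMl//; lra.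
  by rewrite mulr_gt0// exprn_gt0 ?subr_gt0// normc_Euler_Gamma_gt0.
move: pos; rewrite E0 E1 E2 exprMn [leRHS]mulrACA [ltRHS]mulrACA -big_split/= -prodrXl.
set X := normc (Gamma z0) ^+ 2; set Y := normc (Gamma z1) * _.
set U := \prod_(k < n) _ ^+ 2; set W := \prod_(k < n) _.
have U0 : 0 < U.
  rewrite prodr_gt0// => k _; rewrite exprn_gt0// normc_gt0 addc_nat eq_complex/=.
  by rewrite negb_and; apply/orP; left; rewrite gt_eqF//; have := ler0n R k; lra.
have W0 : 0 <= W by rewrite prodr_ge0// => k _; rewrite mulr_ge0 ?normc_ge0.
have Y0 : 0 <= Y by rewrite mulr_ge0 ?normc_ge0.
have X0 : 0 <= X by rewrite sqr_ge0.
have WU : (1 - e) * W ^+ 2 <= q * U ^+ 2.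
  apply: le_trans (_ : (1 - K / n%:R) * W ^+ 2 <= _).
    by rewrite ler_wpM2r ?sqr_ge0// lerD2l lerN2.
  rewrite /W /U -!prodrXl; move: Hq.
  congr (_ * _ <= _ * _); apply: eq_bigr => k _.
    by rewrite exprMn !addc_nat !sqr_normcE sqrrN (addrAC a x) (addrAC a (- x)).
  by rewrite addc_nat sqr_normcE.
move=> YW XY; have Yp : 0 < Y by rewrite lt_def Y0 andbT; apply: contraTneq YW => ->; rewrite mul0r ltxx.
have key : (1 - e) ^+ 5 * X ^+ 2 <= q * Y ^+ 2.
  rewrite -(@ler_pM2r _ (U ^+ 2)) ?exprn_gt0//.
  apply: (@le_trans _ _ ((1 - e) * (Y * W) ^+ 2)).
    have : ((1 - e) ^+ 2 * (X * U)) ^+ 2 <= (Y * W) ^+ 2.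
      rewrite lerXn2r ?nnegrE//; last exact: mulr_ge0.
      by rewrite (mulr_ge0 (sqr_ge0 _))// mulr_ge0// ltW.
    move=> /(ler_wpM2l (_ : 0 <= 1 - e)) h; apply: le_trans (h _); last by lra.
    by rewrite le_eqVlt; apply/orP; left; apply/eqP; ring.
  rewrite exprMn mulrCA [leRHS]mulrAC -[leRHS]mulrC ler_wpM2l ?sqr_ge0//.
rewrite -(@ltr_pXn2r _ 2)// ?nnegrE//.
have b5 : q < (1 - e) ^+ 5.
  have qE : q = 1 - 6 * e by rewrite /e; field.
  have b2 : 1 - 2 * e <= (1 - e) ^+ 2 by have := sqr_ge0 e; rewrite sqrrB; lra.
  have b4 : 1 - 4 * e <= ((1 - e) ^+ 2) ^+ 2 by nra.
  have -> : (1 - e) ^+ 5 = ((1 - e) ^+ 2) ^+ 2 * (1 - e) by ring.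
  nra.
have : (1 - e) ^+ 5 * X ^+ 2 < (1 - e) ^+ 5 * Y ^+ 2.
  by apply: le_lt_trans key _; rewrite ltr_pM2r// exprn_gt0.
by rewrite ltr_pM2l//; apply: le_lt_trans b5.
Qed.

End GammaModulus.

Unset Implicit Arguments.
Set Strict Implicit.

Theorem lemma5p3 (R : realType) (alpha x y : R)
    (halpha : 1 < alpha) (hx : 0 < x)
    (hfinite : ~ Gamma_pole ((alpha / 2 - x) -i* y)) :
  `|Gamma ((alpha / 2 + x) +i* y) * Gamma ((alpha / 2 - x) -i* y)|
    > `|Gamma ((alpha / 2) +i* y)| ^+ 2.
Proof.
have a2 : 2^-1 < alpha / 2 by lra.
rewrite !normrE -rmorphXn ltcR [ltRHS]normcM.
exact: normc_Gamma_lt.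
Qed.
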